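(* Let $A$ be a finite-dimensional $k$-algebra that is not self-injective. Then: (1) $\operatorname{rigdim}(A)\leq \sup\{\, n\in\mathbb{N}_0 \mid \operatorname{Ext}_A^{j}(\mathrm{D}(A),A)=0 \text{ for all } 1\leq j\leq n\,\}+2$. Equality holds if the endomorphism algebra $\operatorname{End}_A(A\oplus \mathrm{D}(A))$ has finite global dimension. (2) $\operatorname{rigdim}(A)\leq \operatorname{injdim}({}_AA)+1\leq \operatorname{gldim}(A)+1$.
   Context: $k$ is an arbitrary fixed field. All algebras are finite-dimensional associative unital $k$-algebras, all modules are finite-dimensional left modules; $A\text{-mod}$ is the category of such $A$-modules. $\mathrm{D}=\operatorname{Hom}_k(-,k)$ is the $k$-duality and $\mathrm{D}(A)$ means $\mathrm{D}(A_A)$ as a left $A$-module. $\operatorname{add}(M)$ is the full subcategory of direct summands of finite direct sums of copies of $M$. An $A$-module $M$ is a generator-cogenerator if $A\in\operatorname{add}(M)$ and $\mathrm{D}(A_A)\in\operatorname{add}(M)$. The dominant dimension $\operatorname{domdim} E$ of an algebra $E$ is the largest $t\in\mathbb{N}_0$, or $\infty$, such that in a minimal injective resolution $0\to {}_EE\to I^0\to I^1\to\cdots$ all $I^i$ with $0\leq i<t$ are projective. $\operatorname{gldim}$ denotes global dimension and $\operatorname{injdim}$ injective dimension. The rigidity dimension of $A$ is $$\operatorname{rigdim}(A)=\sup\{\operatorname{domdim}\operatorname{End}_A(M)\mid M \text{ a generator-cogenerator in } A\text{-mod},\ \operatorname{gldim}\operatorname{End}_A(M)<\infty\}.$$ Suprema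 are allowed to be $\infty$. *)

(* Defs.v *)
From HB Require Import structures.
From mathcomp Require Import all_boot all_order all_algebra all_field.
From mathcomp Require Import boolp classical_sets.

Set Implicit Arguments.
Unset Strict Implicit.
Unset Printing Implicit Defensive.

Import GRing.Theory.
Local Open Scope ring_scope.
Local Open Scope classical_set_scope.

Inductive enat := Fin of nat | Inf.

Definition ele (x y : enat) : bool :=
  match x, y with
  | Fin m, Fin n => (m <= n)%N
  | _, Inf => true
  | Inf, Fin _ => false
  end.

Definition eadd (x y : enat) : enat :=
  match x, y with
  | Fin m, Fin n => Fin (m + n)
  | _, _ => Inf
  end.

Declare Scope enat_scope.
Delimit Scope enat_scope with enat.
Bind Scope enat_scope with enat.
Notation "x <= y" := (ele x y) : enat_scope.
Notation "x + y" := (eadd x y) : enat_scope.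

(* In both definitions ex_minn selects the least element of a nonempty set of
   natural numbers; in particular esup set0 = Fin 0 and einf set0 = Inf. *)
Definition esup (S : set enat) : enat :=
  if pselect (exists n, `[< forall x, S x -> (x <= Fin n)%enat >]) is left ex
  then Fin (ex_minn ex) else Inf.

Definition einf (S : set nat) : enat :=
  if pselect (exists n, `[< S n >]) is left ex
  then Fin (ex_minn ex) else Inf.

Lemma esup_ub (S : set enat) x : S x -> (x <= esup S)%enat.
Proof.
rewrite /esup; case: pselect => [ex|_] Sx; last by case: x Sx.
by case: ex_minnP => n /asboolP/(_ _ Sx).
Qed.

Lemma esup_le (S : set enat) y :
  (forall x, S x -> (x <= y)%enat) -> (esup S <= y)%enat.
Proof.
rewrite /esup; case: pselect => [ex|nex] Sy; case: y Sy => // n Sn.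
  by case: ex_minnP => m _; apply; apply/asboolP.
by case: nex; exists n; apply/asboolP.
Qed.

Record fdmod (k : fieldType) (A : falgType k) := FDMod {
  fdmod_sort :> vectType k;
  act : A -> fdmod_sort -> fdmod_sort;
  act_linearl : forall x, linear (act^~ x);
  act_linearr : forall a, linear (act a);
  act1 : forall x, act 1 x = x;
  actM : forall a b x, act (a * b) x = act a (act b x)
}.

Section Constructions.
Context {k : fieldType} {A : falgType k}.
Implicit Types M N : fdmod A.

Fact regmod_linearl (x : A) : linear (fun a : A => a * x).
Proof. by move=> c a b; rewrite mulrDl scalerAl. Qed.
Fact regmod_linearr (a : A) : linear (fun x : A => a * x).
Proof. by move=> c x y; rewrite mulrDr scalerAr. Qed.
Definition regmod : fdmod A :=
  FDMod regmod_linearl regmod_linearr (@mul1r A)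
    (fun a b x => esym (mulrA a b x)).

(* D(A_A) = Hom_k(A, k), with (a f)(x) = f(x a). *)
Definition dual_act (a : A) (f : 'Hom(A, k^o)) : 'Hom(A, k^o) :=
  (f \o amulr a)%VF.
Fact dual_actE a f x : dual_act a f x = f (x * a).
Proof. by rewrite comp_lfunE lfunE. Qed.
Fact dual_linearl f : linear (dual_act^~ f).
Proof.
move=> c a b; apply/lfunP=> x.
by rewrite add_lfunE scale_lfunE !dual_actE mulrDr -scalerAr linearP.
Qed.
Fact dual_linearr a : linear (dual_act a).
Proof. by move=> c f g; rewrite /dual_act comp_lfunDl -comp_lfunZl. Qed.
Fact dual_act1 f : dual_act 1 f = f.
Proof. by apply/lfunP=> x; rewrite dual_actE mulr1. Qed.
Fact dual_actM a b f : dual_act (a * b) f = dual_act a (dual_act b f).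
Proof. by apply/lfunP=> x; rewrite !dual_actE mulrA. Qed.
Definition dualmod : fdmod A :=
  FDMod dual_linearl dual_linearr dual_act1 dual_actM.

Definition dsum_act M N (a : A) (x : M * N) : M * N :=
  (act a x.1, act a x.2).
Fact dsum_linearl M N (x : M * N) : linear ((@dsum_act M N)^~ x).
Proof. by move=> c a b; rewrite /dsum_act !act_linearl. Qed.
Fact dsum_linearr M N a : linear (@dsum_act M N a).
Proof. by move=> c x y; rewrite /dsum_act !act_linearr. Qed.
Fact dsum_act1 M N x : @dsum_act M N 1 x = x.
Proof. by case: x => x y; rewrite /dsum_act !act1. Qed.
Fact dsum_actM M N a b x :
  @dsum_act M N (a * b) x = dsum_act a (dsum_act b x).
Proof. by rewrite /dsum_act !actM. Qed.
Definition dsum M N : fdmod A :=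
  FDMod (@dsum_linearl M N) (@dsum_linearr M N) (@dsum_act1 M N)
    (@dsum_actM M N).

Definition pow_act M n (a : A) (x : {ffun 'I_n -> M}) : {ffun 'I_n -> M} :=
  [ffun i => act a (x i)].
Fact pow_linearl M n x : linear ((@pow_act M n)^~ x).
Proof. by move=> c a b; apply/ffunP=> i; rewrite !ffunE act_linearl. Qed.
Fact pow_linearr M n a : linear (@pow_act M n a).
Proof. by move=> c x y; apply/ffunP=> i; rewrite !ffunE act_linearr. Qed.
Fact pow_act1 M n x : @pow_act M n 1 x = x.
Proof. by apply/ffunP=> i; rewrite ffunE act1. Qed.
Fact pow_actM M n a b x : @pow_act M n (a * b) x = pow_act a (pow_act b x).
Proof. by apply/ffunP=> i; rewrite !ffunE actM. Qed.
Definition powmod M n : fdmod A :=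
  FDMod (@pow_linearl M n) (@pow_linearr M n) (@pow_act1 M n)
    (@pow_actM M n).

End Constructions.

Arguments regmod {k} A.
Arguments dualmod {k} A.

(* Commuting with the action is imposed on a basis of A, so that Hom_A(M, N)
   is a subspace of 'Hom(M, N) in the sense of vector.v. *)
Definition act_comm (k : fieldType) (A : falgType k) (M N : fdmod A) (a : A)
    (f : 'Hom(M, N)) : 'Hom(M, N) :=
  ((f \o linfun (act a : M -> M)) - (linfun (act a : N -> N) \o f))%VF.

Definition homv (k : fieldType) (A : falgType k) (M N : fdmod A) :
    {vspace 'Hom(M, N)} :=
  (\bigcap_(a <- vbasis {:A}) lker (linfun (@act_comm k A M N a)))%VS.

Section HomTheory.
Context {k : fieldType} {A : falgType k}.
Implicit Types M N L : fdmod A.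

HB.instance Definition _ M a :=
  GRing.isLinear.Build k M M _ (act a : M -> M) (act_linearr a).

Definition actr M (x : M) (a : A) : M := act a x.
HB.instance Definition _ M (x : M) :=
  GRing.isLinear.Build k A M _ (actr x) (act_linearl x).

Fact act_comm_linear M N a : linear (@act_comm k A M N a).
Proof.
move=> c f g; rewrite /act_comm comp_lfunDl comp_lfunDr -comp_lfunZl -comp_lfunZr.
by rewrite scalerBr opprD addrACA.
Qed.
HB.instance Definition _ M N a :=
  GRing.isLinear.Build k _ _ _ (@act_comm k A M N a)
    (act_comm_linear a).

Lemma homvP M N (f : 'Hom(M, N)) :
  f \in homv M N <-> forall a x, f (act a x) = act a (f x).
Proof.
have commE a : (f \in lker (linfun (@act_comm k A M N a))) =
    ((f \o linfun (act a : M -> M)) == (linfun (act a : N -> N) \o f))%VF.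
  by rewrite memv_ker lfunE /= subr_eq0.
have commP a : reflect (forall x, f (act a x) = act a (f x))
    (f \in lker (linfun (@act_comm k A M N a))).
  rewrite commE; apply: (iffP eqP) => [/lfunP E x | E].
    by have := E x; rewrite !comp_lfunE !lfunE.
  by apply/lfunP=> x; rewrite !comp_lfunE !lfunE /= E.
have -> : (f \in homv M N) =
    all (fun a => f \in lker (linfun (@act_comm k A M N a))) (vbasis {:A}).
  rewrite /homv; elim: (tval _) => [|a s IHs]; first by rewrite big_nil memvf.
  by rewrite big_cons memv_cap IHs.
split=> [/allP homf a x | homf]; last by apply/allP=> a _; apply/commP.
have -> : a = \sum_i coord (vbasis {:A}) i a *: (vbasis {:A})`_i.
  by apply: coord_vbasis; rewrite memvf.
rewrite -[LHS]/(f (actr x _)) -[RHS]/(actr (f x) _) !linear_sum.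
apply: eq_bigr => i _; rewrite !linearZ /=; congr (_ *: _).
by apply/commP/homf/mem_nth; rewrite size_tuple.
Qed.

Lemma homv_comp M N L (g : 'Hom(N, L)) (f : 'Hom(M, N)) :
  g \in homv N L -> f \in homv M N -> (g \o f)%VF \in homv M L.
Proof.
move=> /homvP hg /homvP hf; apply/homvP=> a x.
by rewrite !comp_lfunE hf hg.
Qed.

Lemma homv_id M : \1%VF \in homv M M.
Proof. by apply/homvP=> a x; rewrite !id_lfunE. Qed.

Definition isomod M N : Prop :=
  exists f : 'Hom(M, N), f \in homv M N /\ bijective f.

(* falgType excludes the zero algebra, hence the hypothesis on M; the product
   is composition of maps, (f * g) x = f (g x). *)
Definition endalg M (M_neq0 : (0 < \dim {:M})%N) : Type := subvs_of (homv M M).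

Section EndAlgebra.
Variables (M : fdmod A) (M_neq0 : (0 < \dim {:M})%N).
Local Notation E := (endalg M_neq0).

HB.instance Definition _ := Vector.on E.

Definition endalg_one : E := Subvs (homv_id M).
Definition endalg_mul (f g : E) : E :=
  Subvs (homv_comp (subvsP f) (subvsP g)).

Fact endalg_mulA : associative endalg_mul.
Proof. by move=> f g h; apply/val_inj/comp_lfunA. Qed.
Fact endalg_mul1l : left_id endalg_one endalg_mul.
Proof. by move=> f; apply/val_inj/comp_lfun1l. Qed.
Fact endalg_mul1r : right_id endalg_one endalg_mul.
Proof. by move=> f; apply/val_inj/comp_lfun1r. Qed.
Fact endalg_mulDl : left_distributive endalg_mul +%R.
Proof. by move=> f g h; apply/val_inj/comp_lfunDl. Qed.
Fact endalg_mulDr : right_distributive endalg_mul +%R.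
Proof. by move=> f g h; apply/val_inj/comp_lfunDr. Qed.
Fact endalg_1neq0 : endalg_one != 0.
Proof.
apply/eqP=> /(congr1 val) /= /lfunP e0; move: M_neq0.
suff -> : ({:M} = 0)%VS by rewrite dimv0.
apply/eqP; rewrite -subv0; apply/subvP=> x _.
by have := e0 x; rewrite !lfunE /= => ->; rewrite mem0v.
Qed.

HB.instance Definition _ := GRing.Zmodule_isNzRing.Build E
  endalg_mulA endalg_mul1l endalg_mul1r endalg_mulDl endalg_mulDr endalg_1neq0.

Fact endalg_scalerAl (c : k) (f g : E) : c *: (f * g) = (c *: f) * g.
Proof. by apply/val_inj; rewrite /= comp_lfunZl. Qed.
HB.instance Definition _ :=
  GRing.Lmodule_isLalgebra.Build k E endalg_scalerAl.

Fact endalg_scalerAr (c : k) (f g : E) : c *: (f * g) = f * (c *: g).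
Proof. by apply/val_inj; rewrite /= comp_lfunZr. Qed.
HB.instance Definition _ := GRing.Lalgebra_isAlgebra.Build k E endalg_scalerAr.

HB.instance Definition _ := Algebra_isFalgebra.Build k E.

End EndAlgebra.
End HomTheory.

Section Homological.
Context {k : fieldType} {A : falgType k}.
Implicit Types M N L X Y : fdmod A.

Definition projective_mod (P : fdmod A) : Prop :=
  forall N L (g : 'Hom(N, L)) (f : 'Hom(P, L)),
    g \in homv N L -> f \in homv P L -> limg g = fullv ->
    exists2 h : 'Hom(P, N), h \in homv P N & (g \o h)%VF = f.

Definition injective_mod (I : fdmod A) : Prop :=
  forall N L (g : 'Hom(N, L)) (f : 'Hom(N, I)),
    g \in homv N L -> f \in homv N I -> lker g = 0%VS ->
    exists2 h : 'Hom(L, I), h \in homv L I & (h \o g)%VF = f.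

Definition in_add M X : Prop :=
  exists (n : nat) (Y : fdmod A), isomod (dsum X Y) (powmod M n).

Definition generator_cogenerator M : Prop :=
  in_add M (regmod A) /\ in_add M (dualmod A).

Definition submodv M (U : {vspace M}) : Prop :=
  forall (a : A) x, x \in U -> act a x \in U.

Definition essentialv M (U : {vspace M}) : Prop :=
  forall W : {vspace M}, submodv W -> (U :&: W = 0)%VS -> W = 0%VS.

Record projective_resolution X (P : nat -> fdmod A) (e : 'Hom(P 0%N, X))
    (d : forall i, 'Hom(P i.+1, P i)) : Prop := {
  pres_proj : forall i, projective_mod (P i);
  pres_hom0 : e \in homv (P 0%N) X;
  pres_hom : forall i, d i \in homv (P i.+1) (P i);
  pres_surj : limg e = fullv;
  pres_exact0 : limg (d 0%N) = lker e;
  pres_exact : forall i, limg (d i.+1) = lker (d i)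
}.

Record injective_resolution X (I : nat -> fdmod A) (e : 'Hom(X, I 0%N))
    (d : forall i, 'Hom(I i, I i.+1)) : Prop := {
  ires_inj : forall i, injective_mod (I i);
  ires_hom0 : e \in homv X (I 0%N);
  ires_hom : forall i, d i \in homv (I i) (I i.+1);
  ires_mono : lker e = 0%VS;
  ires_exact0 : limg e = lker (d 0%N);
  ires_exact : forall i, limg (d i) = lker (d i.+1)
}.

(* Minimality: I 0 is an injective envelope of X, and I i.+1 is an injective
   envelope of the image of d i. *)
Definition minimal_injective_resolution X (I : nat -> fdmod A)
    (e : 'Hom(X, I 0%N)) (d : forall i, 'Hom(I i, I i.+1)) : Prop :=
  [/\ injective_resolution e d, essentialv (limg e)
    & forall i, essentialv (limg (d i))].

Definition projdim X : enat :=
  einf [set n | exists (P : nat -> fdmod A) (e : 'Hom(P 0%N, X))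
      (d : forall i, 'Hom(P i.+1, P i)),
    projective_resolution e d /\ forall i, (n < i)%N -> \dim {:P i} = 0%N].

Definition injdim X : enat :=
  einf [set n | exists (I : nat -> fdmod A) (e : 'Hom(X, I 0%N))
      (d : forall i, 'Hom(I i, I i.+1)),
    injective_resolution e d /\ forall i, (n < i)%N -> \dim {:I i} = 0%N].

(* Cochains of degree j are Hom_A(P j, Y), with differential f |-> f \o d j,
   and Ext_A^j(X, Y) is the quotient of cocycles by coboundaries; it does not
   depend on the projective resolution P of X. *)
Definition ext_diff (P : nat -> fdmod A) (d : forall i, 'Hom(P i.+1, P i)) Y j :
    'Hom('Hom(P j, Y), 'Hom(P j.+1, Y)) :=
  linfun (fun f : 'Hom(P j, Y) => (f \o d j)%VF).

Definition ext_cocycles (P : nat -> fdmod A)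
    (d : forall i, 'Hom(P i.+1, P i)) Y j : {vspace 'Hom(P j, Y)} :=
  (homv (P j) Y :&: lker (ext_diff d Y j))%VS.

Definition ext_coboundaries (P : nat -> fdmod A)
    (d : forall i, 'Hom(P i.+1, P i)) Y j : {vspace 'Hom(P j, Y)} :=
  match j with
  | 0 => 0%VS
  | i.+1 => (ext_diff d Y i @: homv (P i) Y)%VS
  end.

Lemma ext_diffE (P : nat -> fdmod A) (d : forall i, 'Hom(P i.+1, P i)) Y j f :
  ext_diff d Y j f = (f \o d j)%VF.
Proof.
pose F (g : 'Hom(P j, Y)) := (g \o d j)%VF.
have linF : linear F by move=> c g h; rewrite /F comp_lfunDl -comp_lfunZl.
pose FL := GRing.isLinear.Build k _ _ _ F linF.
pose Flin : {linear 'Hom(P j, Y) -> 'Hom(P j.+1, Y)} := HB.pack F FL.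
exact: (lfunE Flin f).
Qed.

Definition ext_zero j X Y : Prop :=
  exists (P : nat -> fdmod A) (e : 'Hom(P 0%N, X))
      (d : forall i, 'Hom(P i.+1, P i)),
    projective_resolution e d /\
    (ext_cocycles d Y j <= ext_coboundaries d Y j)%VS.

End Homological.

Definition self_injective (k : fieldType) (A : falgType k) : Prop :=
  injective_mod (regmod A).

Definition gldim (k : fieldType) (A : falgType k) : enat :=
  esup [set t | exists X : fdmod A, t = projdim X].

Definition domdim (k : fieldType) (E : falgType k) : enat :=
  esup [set Fin t | t in [set t : nat |
    exists (I : nat -> fdmod E) (e : 'Hom(regmod E, I 0%N))
        (d : forall i, 'Hom(I i, I i.+1)),
      minimal_injective_resolution e d /\
      forall i, (i < t)%N -> projective_mod (I i)]].

(* A generator-cogenerator M is automatically nonzero since A is nonzero, so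
   M_neq0 only serves to form the endomorphism algebra. *)
Definition rigdim (k : fieldType) (A : falgType k) : enat :=
  esup [set t | exists (M : fdmod A) (M_neq0 : (0 < \dim {:M})%N),
    [/\ generator_cogenerator M, gldim (endalg M_neq0) <> Inf
      & t = domdim (endalg M_neq0)]].

(* Needed to form End_A(A (+) D(A)) as a falgType. *)
Lemma dsum_reg_dual_neq0 (k : fieldType) (A : falgType k) :
  (0 < \dim {:dsum (regmod A) (dualmod A)})%N.
Proof.
rewrite lt0n dimv_eq0; apply/eqP=> e.
have : ((1, 0) : dsum (regmod A) (dualmod A)) \in
    {:dsum (regmod A) (dualmod A)}%VS by exact: memvf.
by rewrite e memv0 => /eqP[/eqP]; rewrite oner_eq0.
Qed.

(* Main.v *)
(* Let E = End_A(M) for a generator-cogenerator M. As a left E-module, M is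
   projective because A is in add M and injective because D(A) is in add M; by
   the double centralizer property End_E(M) = A, every projective-injective
   E-module is a summand of a power of M, and Hom_A(-, M) and Hom_E(-, M) are
   inverse dualities between the projective A-modules and these E-modules.
   Applying Hom_E(-, M) to an injective resolution of E gives a projective
   resolution of M as long as the terms are projective; conversely Hom_A(-, M)
   turns a projective resolution of M into a coresolution of E, exact as long as
   Ext_A^j(M, M) vanishes. Hence domdim E >= n + 2 iff Ext_A^j(M, M) = 0 for
   1 <= j <= n (Mueller). The vanishing restricts to the summands D(A) and A of
   M, and for M = A + D(A) it amounts to Ext_A^j(D(A), A) = 0. Finally, if A has
   injective dimension n and Ext_A^j(D(A), A) = 0 for 1 <= j <= n, the injective
   resolution of A splits from its end, and A is self-injective. *)

From HB Require Import structures.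
Require Import Defs.
From mathcomp Require Import all_boot all_order all_algebra all_field.
From mathcomp Require Import boolp classical_sets.

Set Implicit Arguments.
Unset Strict Implicit.
Unset Printing Implicit Defensive.

Import GRing.Theory.

(** * Linear maps between finite-dimensional spaces *)

Section LinearMaps.
Local Open Scope ring_scope.
Context {k : fieldType}.
Implicit Types U V W : vectType k.

Lemma lfun_of U V (F : U -> V) :
  linear F -> exists f : 'Hom(U, V), forall x, f x = F x.
Proof.
move=> linF.
pose FL := GRing.isLinear.Build k _ _ _ F linF.
pose Flin : {linear U -> V} := HB.pack F FL.
by exists (linfun Flin) => x; rewrite lfunE.
Qed.

Lemma limgP U V (f : 'Hom(U, V)) y : y \in limg f <-> exists x, y = f x.
Proof.
split=> [/memv_imgP[x _ ->]|[x ->]]; first by exists x.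
exact/memv_img/memvf.
Qed.

Lemma limgTP U V (f : 'Hom(U, V)) :
  limg f = fullv <-> forall y, exists x, y = f x.
Proof.
split=> [fT y|surj]; first by apply/limgP; rewrite fT memvf.
by apply/vspaceP=> y; rewrite memvf; apply/limgP.
Qed.

Lemma lker0I U V (f : 'Hom(U, V)) : lker f = 0%VS <-> injective f.
Proof. by split=> [/eqP/lker0P|/lker0P/eqP]. Qed.

Lemma lfun_inj U V (f : 'Hom(U, V)) :
  (forall x, f x = 0 -> x = 0) -> injective f.
Proof.
move=> f0 x y /eqP; rewrite -subr_eq0 -linearB /= => /eqP/f0/eqP.
by rewrite subr_eq0 => /eqP.
Qed.

Lemma dimv_fullv0 V : \dim {:V} = 0%N <-> forall x : V, x = 0.
Proof.
split=> [/eqP|V0].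
  by rewrite dimv_eq0 => /eqP V0 x; apply/eqP; rewrite -memv0 -V0 memvf.
apply/eqP; rewrite dimv_eq0 -subv0; apply/subvP=> x _.
by rewrite (V0 x) mem0v.
Qed.

Lemma lfun_extend U V W (g : 'Hom(U, V)) (f : 'Hom(U, W)) :
  injective g -> exists h : 'Hom(V, W), forall x, h (g x) = f x.
Proof.
move=> /lker0P g_inj; exists (f \o g^-1)%VF => x.
by rewrite comp_lfunE lker0_lfunK.
Qed.

End LinearMaps.

(** * Submodules, quotients, factorizations and short exact sequences *)

Section Modules.
Local Open Scope ring_scope.
Context {k : fieldType} {A : falgType k}.
Implicit Types M N L X Y Z I P Q K C : fdmod A.

Lemma hom_act M N (f : 'Hom(M, N)) a x :
  f \in homv M N -> f (act a x) = act a (f x).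
Proof. by move/homvP. Qed.

Lemma hom_of M N (F : M -> N) : linear F ->
  (forall a x, F (act a x) = act a (F x)) ->
  exists2 f : 'Hom(M, N), f \in homv M N & forall x, f x = F x.
Proof.
move=> /lfun_of[f fE] Fa; exists f => //.
by apply/homvP=> a x; rewrite !fE Fa.
Qed.

Lemma hom_sum M N n (F : 'I_n -> 'Hom(M, N)) :
  (forall j, F j \in homv M N) -> \sum_j F j \in homv M N.
Proof. by move=> hF; apply: rpred_sum. Qed.

Lemma homB M N (f g : 'Hom(M, N)) :
  f \in homv M N -> g \in homv M N -> f - g \in homv M N.
Proof. exact: rpredB. Qed.

Lemma limg_submod M N (f : 'Hom(M, N)) : f \in homv M N -> submodv (limg f).
Proof.
by move=> hf a _ /limgP[x ->]; apply/limgP; exists (act a x); rewrite hom_act.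
Qed.

Lemma lker_submod M N (f : 'Hom(M, N)) : f \in homv M N -> submodv (lker f).
Proof.
move=> hf a x; rewrite !memv_ker hom_act // => /eqP->.
by rewrite linear0.
Qed.

Lemma submod_exists M (U : {vspace M}) : submodv U ->
  exists (K : fdmod A) (i : 'Hom(K, M)),
    [/\ i \in homv K M, injective i & limg i = U].
Proof.
move=> hU; pose F (a : A) (x : subvs_of U) := vsproj U (act a (vsval x)).
have FE a x : vsval (F a x) = act a (vsval x).
  by rewrite /F vsprojK // hU // subvsP.
have Fl x : linear (F^~ x).
  by move=> c a b; apply: val_inj; rewrite /= !FE act_linearl.
have Fr a : linear (F a).
  by move=> c x y; apply: val_inj; rewrite /= !FE act_linearr.
have F1 x : F 1 x = x by apply: val_inj; rewrite /= FE act1.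
have FM a b x : F (a * b) x = F a (F b x).
  by apply: val_inj; rewrite /= !FE actM.
pose K := FDMod Fl Fr F1 FM.
have [||i hi iE] := @hom_of K M (@vsval k M U).
- by move=> c x y; rewrite linearP.
- exact: FE.
exists K, i; split=> //.
  by move=> x y; rewrite !iE => /subvs_inj.
apply/vspaceP=> x; apply/idP/idP=> [/limgP[y ->]|xU].
  by rewrite iE subvsP.
by apply/limgP; exists (vsproj U x); rewrite iE vsprojK.
Qed.

(** The quotient is carried by a linear complement of [U]: an element acts on it as in [M], followed
    by the projection [q] along [U]. Since [x - q x] lies in the submodule [U], this is again an
    action and [q] is a homomorphism. *)
Lemma quotient_exists M (U : {vspace M}) : submodv U ->
  exists (C : fdmod A) (p : 'Hom(M, C)),
    [/\ p \in homv M C, forall z, exists x, z = p x & lker p = U].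
Proof.
move=> hU; pose V := (U^C)%VS; pose q := daddv_pi V U.
have cap0 : (V :&: U = 0)%VS by rewrite capvC capv_compl.
have kq x : (x \in U) = (q x == 0).
  have x_in : x \in (V + U)%VS by rewrite addvC addv_complf memvf.
  have eqx := daddv_pi_add cap0 x_in.
  apply/idP/eqP=> [xU|qx0]; last first.
    by rewrite -eqx -/q qx0 add0r memv_pi.
  apply/eqP; rewrite -memv0 -cap0 memv_cap memv_pi /=.
  have -> : q x = x - daddv_pi U V x by rewrite -[X in X - _]eqx addrK.
  by rewrite memvB // memv_pi.
have qV x : x \in V -> q x = x by exact: daddv_pi_id.
pose F (a : A) (x : subvs_of V) := vsproj V (q (act a (vsval x))).
have FE a x : vsval (F a x) = q (act a (vsval x)).
  by rewrite /F vsprojK // memv_pi.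
have qact a x : q (act a (q x)) = q (act a x).
  apply/eqP; rewrite -subr_eq0 -linearB -linearB /= -kq; apply: hU.
  rewrite kq linearB /= (qV (q x)) ?subrr //; exact: memv_pi.
have Fl x : linear (F^~ x).
  by move=> c a b; apply: val_inj; rewrite /= !FE act_linearl linearP.
have Fr a : linear (F a).
  by move=> c x y; apply: val_inj; rewrite /= !FE act_linearr linearP.
have F1 x : F 1 x = x.
  by apply: val_inj; rewrite /= FE act1 qV // subvsP.
have FM a b x : F (a * b) x = F a (F b x).
  by apply: val_inj; rewrite /= !FE actM qact.
pose C := FDMod Fl Fr F1 FM.
have [|a x|p hp pE] := @hom_of M C (fun x => vsproj V (q x)).
- by move=> c x y; rewrite linearP /= linearP.
- by apply: val_inj; rewrite /= FE vsprojK ?memv_pi // vsprojK ?memv_pi // qact.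
exists C, p; split=> //.
  move=> z; exists (vsval z); rewrite pE qV ?subvsP //.
  by rewrite vsvalK.
apply/vspaceP=> x; rewrite memv_ker kq pE.
apply/eqP/eqP=> [/(congr1 (@vsval _ _ _))|->]; last by rewrite linear0.
by rewrite vsprojK ?memv_pi.
Qed.

(** The linear pseudo-inverse of [i] need not commute with the action, but its composite with [f]
    does, as can be tested after the injective map [i]. *)
Lemma factor_mono K N X (i : 'Hom(K, N)) (f : 'Hom(X, N)) :
  i \in homv K N -> f \in homv X N -> injective i ->
  (forall x, exists y, f x = i y) ->
  exists2 h : 'Hom(X, K), h \in homv X K & forall x, i (h x) = f x.
Proof.
move=> hi hf i_inj fi; pose h := (i^-1 \o f)%VF.
have hE x : i (h x) = f x.
  by rewrite comp_lfunE; apply: limg_lfunVK; apply/limgP/fi.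
exists h => //; apply/homvP=> a x; apply: i_inj.
by rewrite hE !hom_act // hE.
Qed.

Lemma factor_epi N C X (p : 'Hom(N, C)) (f : 'Hom(N, X)) :
  p \in homv N C -> f \in homv N X -> (forall z, exists x, z = p x) ->
  (forall x, p x = 0 -> f x = 0) ->
  exists2 h : 'Hom(C, X), h \in homv C X & forall x, h (p x) = f x.
Proof.
move=> hp hf p_surj pf; pose h := (f \o p^-1)%VF.
have hE x : h (p x) = f x.
  apply/eqP; rewrite -subr_eq0 comp_lfunE -linearB /=; apply/eqP/pf.
  rewrite linearB /= limg_lfunVK ?subrr //; exact/memv_img/memvf.
exists h => //; apply/homvP=> a z; have [x ->] := p_surj z.
by rewrite -hom_act // !hE hom_act.
Qed.

Record ses X Y Z (f : 'Hom(X, Y)) (g : 'Hom(Y, Z)) : Prop := {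
  ses_homl : f \in homv X Y;
  ses_homr : g \in homv Y Z;
  ses_inj : injective f;
  ses_exact : forall y, g y = 0 <-> exists x, y = f x;
  ses_surj : forall z, exists y, z = g y
}.

Lemma ses_comp0 X Y Z (f : 'Hom(X, Y)) (g : 'Hom(Y, Z)) x :
  ses f g -> g (f x) = 0.
Proof. by move=> s; apply/(ses_exact s); exists x. Qed.

Lemma ses_coker X Y (f : 'Hom(X, Y)) : f \in homv X Y -> injective f ->
  exists Z (g : 'Hom(Y, Z)), ses f g.
Proof.
move=> hf f_inj.
have [Z [g [hg g_surj kg]]] := quotient_exists (limg_submod hf).
exists Z, g; split=> // y; rewrite -limgP -kg memv_ker.
by split=> /eqP.
Qed.

Lemma ses_ker Y Z (g : 'Hom(Y, Z)) : g \in homv Y Z ->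
  (forall z, exists y, z = g y) -> exists X (f : 'Hom(X, Y)), ses f g.
Proof.
move=> hg g_surj.
have [X [f [hf f_inj If]]] := submod_exists (lker_submod hg).
exists X, f; split=> // y; rewrite -limgP If memv_ker.
by split=> /eqP.
Qed.

End Modules.

(** * Projective and injective modules *)

Section ProjectiveInjective.
Local Open Scope ring_scope.
Context {k : fieldType} {A : falgType k}.
Implicit Types M N L X Y Z I P Q K C : fdmod A.

Lemma projective_modP P : projective_mod P <->
  forall N L (g : 'Hom(N, L)) (f : 'Hom(P, L)),
    g \in homv N L -> f \in homv P L -> (forall z, exists y, z = g y) ->
    exists2 h : 'Hom(P, N), h \in homv P N & forall x, g (h x) = f x.
Proof.
split=> projP N L g f hg hf.
  move=> /limgTP/(projP _ _ _ _ hg hf)[h hh <-].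
  by exists h => // x; rewrite comp_lfunE.
move=> /limgTP/(projP _ _ _ _ hg hf)[h hh hE].
by exists h => //; apply/lfunP=> x; rewrite comp_lfunE.
Qed.

Lemma injective_modP I : injective_mod I <->
  forall N L (g : 'Hom(N, L)) (f : 'Hom(N, I)),
    g \in homv N L -> f \in homv N I -> injective g ->
    exists2 h : 'Hom(L, I), h \in homv L I & forall x, h (g x) = f x.
Proof.
split=> injI N L g f hg hf.
  move=> /lker0I/(injI _ _ _ _ hg hf)[h hh <-].
  by exists h => // x; rewrite comp_lfunE.
move=> /lker0I/(injI _ _ _ _ hg hf)[h hh hE].
by exists h => //; apply/lfunP=> x; rewrite comp_lfunE.
Qed.

(** Membership in add(M) through a decomposition of the identity of [X] into maps factoring through
    [M]; neither a complement nor an explicit power of [M] has to be exhibited. *)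
Definition summand M X : Prop :=
  exists n (i : 'I_n -> 'Hom(X, M)) (p : 'I_n -> 'Hom(M, X)),
  [/\ forall j, i j \in homv X M, forall j, p j \in homv M X
    & forall x, \sum_j p j (i j x) = x].

Lemma summand1 M X (i : 'Hom(X, M)) (p : 'Hom(M, X)) :
  i \in homv X M -> p \in homv M X -> (forall x, p (i x) = x) -> summand M X.
Proof.
move=> hi hp pi; exists 1%N, (fun=> i), (fun=> p); split=> // x.
by rewrite big_ord1.
Qed.

Lemma projective_summand P X :
  projective_mod P -> summand P X -> projective_mod X.
Proof.
move=> /projective_modP projP [n [i [p [hi hp pi]]]].
apply/projective_modP=> N L g f hg hf g_surj.
have /choice[h hE] j : exists h, h \in homv P N /\ forall x, g (h x) = f (p j x).
  have [|h hh hE] := projP N L g (f \o p j)%VF hg _ g_surj.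
    exact: homv_comp.
  by exists h; split=> // x; rewrite hE comp_lfunE.
exists (\sum_j (h j \o i j)%VF).
  by apply: hom_sum => j; apply: homv_comp (hi j); case: (hE j).
move=> x; rewrite sum_lfunE linear_sum -[in RHS](pi x) linear_sum.
by apply: eq_bigr => j _; rewrite comp_lfunE /=; case: (hE j) => _ ->.
Qed.

Lemma injective_summand I X :
  injective_mod I -> summand I X -> injective_mod X.
Proof.
move=> /injective_modP injI [n [i [p [hi hp pi]]]].
apply/injective_modP=> N L g f hg hf g_inj.
have /choice[h hE] j : exists h, h \in homv L I /\ forall x, h (g x) = i j (f x).
  have [|h hh hE] := injI N L g (i j \o f)%VF hg _ g_inj.
    exact: homv_comp.
  by exists h; split=> // x; rewrite hE comp_lfunE.
exists (\sum_j (p j \o h j)%VF).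
  by apply: hom_sum => j; apply: homv_comp (hp j) _; case: (hE j).
move=> x; rewrite sum_lfunE -[in RHS](pi (f x)).
by apply: eq_bigr => j _; rewrite comp_lfunE /=; case: (hE j) => _ ->.
Qed.

Lemma pow_map X M n (h : 'I_n -> 'Hom(X, M)) :
  (forall j, h j \in homv X M) ->
  exists2 f : 'Hom(X, powmod M n), f \in homv X (powmod M n)
    & forall x j, (f x : {ffun _}) j = h j x.
Proof.
move=> hh; have [||f hf fE] := @hom_of _ _ X (powmod M n) (fun x => [ffun j => h j x]).
- by move=> c x y; apply/ffunP=> j; rewrite !ffunE linearP.
- by move=> a x; apply/ffunP=> j; rewrite !ffunE hom_act.
by exists f => // x j; rewrite fE ffunE.
Qed.

Lemma pow_summand M n : summand M (powmod M n).
Proof.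
have /choice[i iE] (j : 'I_n) : exists i : 'Hom(powmod M n, M),
    i \in homv (powmod M n) M /\ forall x, i x = (x : {ffun _}) j.
  have [||i hi iE] := @hom_of _ _ (powmod M n) M (fun x => (x : {ffun _}) j).
  - by move=> c x y; rewrite !ffunE.
  - by move=> a x; rewrite ffunE.
  by exists i.
have /choice[p pE] (j : 'I_n) : exists p : 'Hom(M, powmod M n),
    p \in homv M (powmod M n) /\
    forall x, p x = [ffun l => if l == j then x else 0].
  have [||p hp pE] := @hom_of _ _ M (powmod M n)
      (fun x => [ffun l => if l == j then x else 0]).
  - move=> c x y; apply/ffunP=> l; rewrite !ffunE.
    by case: ifP => // _; rewrite scaler0 addr0.
  - move=> a x; apply/ffunP=> l; rewrite !ffunE.
    by case: ifP => // _; rewrite linear0.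
  by exists p.
exists n, i, p; split=> [j|j|x]; try by case: (iE j); case: (pE j).
apply/ffunP=> l; rewrite sum_ffunE (bigD1 l) //= big1 => [|j jl].
  by case: (pE l) => _ ->; case: (iE l) => _ ->; rewrite ffunE eqxx addr0.
by case: (pE j) => _ ->; rewrite ffunE eq_sym (negPf jl).
Qed.

Lemma summand_trans M N X : summand M N -> summand N X -> summand M X.
Proof.
move=> [m [i [p [hi hp pi]]]] [n [i' [p' [hi' hp' pi']]]].
(* The composite decomposition is indexed by pairs, enumerated as ordinals. *)
pose f (t : 'I_#|{: 'I_n * 'I_m}|) := enum_val t : 'I_n * 'I_m.
exists _, (fun t => (i (f t).2 \o i' (f t).1)%VF),
  (fun t => (p' (f t).1 \o p (f t).2)%VF).
split=> [j|j|x]; try exact: homv_comp.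
rewrite -[RHS]pi'.
under [RHS]eq_bigr => j _ do rewrite -[i' j x]pi linear_sum.
rewrite pair_bigA /= (big_enum_val _ (A := {: 'I_n * 'I_m})) /=.
by apply: eq_bigr => t _; rewrite !comp_lfunE.
Qed.

Lemma in_add_summand M X : in_add M X -> summand M X.
Proof.
move=> [n [Y [f [hf f_bij]]]]; apply: summand_trans (pow_summand M n) _.
have f_inj : injective f by exact: bij_inj.
have [f' _ f'K] := f_bij.
have [|g hg fg] := factor_mono hf (homv_id _) f_inj.
  by move=> x; exists (f' x); rewrite f'K id_lfunE.
have [||i hi iE] := @hom_of _ _ X (dsum X Y) (fun x => (x, 0)).
- by move=> c x y; rewrite -[RHS]/(c *: x + y, c *: 0 + 0) scaler0 addr0.
- by move=> a x; rewrite /= /dsum_act /= linear0.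
have [||p hp pE] := @hom_of _ _ (dsum X Y) X fst; try by [].
apply: (@summand1 _ _ (f \o i)%VF (p \o g)%VF); try exact: homv_comp.
move=> x; rewrite !comp_lfunE pE iE; set z := (x, 0).
by have /f_inj -> : f (g (f z)) = f z by rewrite fg id_lfunE.
Qed.

Lemma projective_regmod : projective_mod (regmod A).
Proof.
apply/projective_modP=> N L g f hg hf g_surj; have [y fy] := g_surj (f 1).
exists (linfun (actr y)) => [|a].
  by apply/homvP=> a b; rewrite !lfunE /= /actr actM.
by rewrite lfunE /= hom_act // -fy -hom_act //= mulr1.
Qed.

(** Half of the adjunction between Hom_A(X, D(A)) and the k-dual of [X]; the other half is
    evaluation at 1. It reduces the injectivity of D(A) to the extension of functionals. *)
Lemma hom_to_dual X (l : 'Hom(X, k^o)) :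
  exists2 f : 'Hom(X, dualmod A), f \in homv X (dualmod A)
    & forall x a, (f x : 'Hom(A, k^o)) a = l (act a x).
Proof.
pose F x : 'Hom(A, k^o) := (l \o linfun (actr x))%VF.
have FE x a : F x a = l (act a x) by rewrite comp_lfunE lfunE.
have [||f hf fE] := @hom_of _ _ X (dualmod A) F.
- move=> c x y; apply/lfunP=> a.
  by rewrite add_lfunE scale_lfunE !FE !linearP.
- by move=> a x; apply/lfunP=> b; rewrite dual_actE !FE actM.
by exists f => // x a; rewrite fE FE.
Qed.

Lemma injective_dualmod : injective_mod (dualmod A).
Proof.
apply/injective_modP=> N L g f hg hf g_inj.
have [|l lE] := @lfun_of k N k^o (fun x => (f x : 'Hom(A, k^o)) 1).
  by move=> c x y; rewrite linearP add_lfunE scale_lfunE.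
have [l' l'E] := lfun_extend l g_inj.
have [h hh hE] := hom_to_dual l'.
exists h => // x; apply/lfunP=> a.
by rewrite hE -hom_act // l'E lE hom_act // dual_actE mul1r.
Qed.

Lemma functionals_separate (V : vectType k) (x : V) :
  (forall l : 'Hom(V, k^o), l x = 0) -> x = 0.
Proof.
move=> x0; rewrite (coord_vbasis (memvf x)) big1 // => j _.
have [|l lE] := @lfun_of k V k^o (coord (vbasis fullv) j).
  by move=> c u v; rewrite linearP.
by rewrite -lE x0 scale0r.
Qed.

(** A basis of Hom_A(I, M) gives a map from [I] to a power of [M]. It is injective because
    homomorphisms to [M] separate points, and it splits because [I] is injective. *)
Lemma summand_of_separated M I : injective_mod I ->
  (forall x : I, (forall h, h \in homv I M -> h x = 0) -> x = 0) -> summand M I.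
Proof.
move=> /injective_modP injI sep; apply: (summand_trans (pow_summand M (\dim (homv I M)))).
have [j|f hf fE] := @pow_map I M (\dim (homv I M)) (fun j => (vbasis (homv I M))`_j).
  by apply: vbasis_mem; rewrite mem_nth // size_tuple.
have f_inj : injective f.
  apply: lfun_inj => x fx0; apply: sep => h hh.
  rewrite (coord_vbasis hh) sum_lfunE big1 // => j _.
  by rewrite scale_lfunE -fE fx0 ffunE scaler0.
have [r hr rE] := injI _ _ _ _ hf (homv_id _) f_inj.
by apply: summand1 hf hr _ => x; rewrite rE id_lfunE.
Qed.

Lemma dual_separates X (x : X) :
  (forall h, h \in homv X (dualmod A) -> h x = 0) -> x = 0.
Proof.
move=> x0; apply: functionals_separate => l; have [h hh hE] := hom_to_dual l.
by rewrite -[x]act1 -hE x0 // zero_lfunE.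
Qed.

Lemma summand_injective I : injective_mod I -> summand (dualmod A) I.
Proof. by move=> injI; apply: summand_of_separated => //; apply: dual_separates. Qed.

Lemma injective_embedding X : exists (J : fdmod A) (j : 'Hom(X, J)),
  [/\ injective_mod J, j \in homv X J & injective j].
Proof.
pose n := \dim (homv X (dualmod A)); pose b := vbasis (homv X (dualmod A)).
have [j|f hf fE] := @pow_map X (dualmod A) n (fun j => b`_j).
  by apply: vbasis_mem; rewrite mem_nth // size_tuple.
exists (powmod (dualmod A) n), f; split=> //.
  exact: injective_summand injective_dualmod (pow_summand _ _).
apply: lfun_inj => x fx0; apply: dual_separates => h hh.
rewrite (coord_vbasis hh) sum_lfunE big1 // => j _.
by rewrite scale_lfunE -fE fx0 ffunE scaler0.
Qed.

Lemma free_cover X :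
  exists n (p : 'Hom(powmod (regmod A) n, X)),
    p \in homv (powmod (regmod A) n) X /\ forall x, exists y, x = p y.
Proof.
pose b := vbasis {:X}; pose n := \dim {:X}.
have [||f hf fE] := @hom_of _ _ (powmod (regmod A) n) X
    (fun y : {ffun 'I_n -> A} => \sum_j act (y j) b`_j).
- move=> c x y; rewrite linear_sum -big_split; apply: eq_bigr => j _.
  by rewrite !ffunE act_linearl.
- move=> a x; rewrite linear_sum; apply: eq_bigr => j _.
  by rewrite ffunE /= actM.
exists n, f; split=> // x.
exists [ffun j => (coord b j x)%:A]; rewrite fE {1}(coord_vbasis (memvf x)).
apply: eq_bigr => j _; rewrite ffunE.
by rewrite -[act _ _]/(actr _ _) linearZ /= /actr act1.
Qed.

Lemma projective_cover X : exists (P : fdmod A) (p : 'Hom(P, X)),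
  [/\ projective_mod P, p \in homv P X & forall x, exists y, x = p y].
Proof.
have [n [p [hp p_surj]]] := free_cover X; exists (powmod (regmod A) n), p; split=> //.
exact: projective_summand projective_regmod (pow_summand _ _).
Qed.

Lemma summand_projective P : projective_mod P -> summand (regmod A) P.
Proof.
move=> /projective_modP projP; have [n [p [hp p_surj]]] := free_cover P.
have [s hs sE] := projP _ _ _ _ hp (homv_id _) p_surj.
apply: summand_trans (pow_summand _ n) _.
by apply: summand1 hs hp _ => x; rewrite sE id_lfunE.
Qed.

End ProjectiveInjective.

(** * Vanishing of Ext *)

Section ExtVanishing.
Local Open Scope ring_scope.
Context {k : fieldType} {A : falgType k}.
Implicit Types M N L X Y Z I P Q K C : fdmod A.

Lemma ses_injective X : exists (I Z : fdmod A) (f : 'Hom(X, I)) (g : 'Hom(I, Z)),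
  ses f g /\ injective_mod I.
Proof.
have [I [f [injI hf f_inj]]] := injective_embedding X.
by have [Z [g sfg]] := ses_coker hf f_inj; exists I, Z, f, g.
Qed.

Lemma ses_projective X : exists (K P : fdmod A) (i : 'Hom(K, P)) (p : 'Hom(P, X)),
  ses i p /\ projective_mod P.
Proof.
have [P [p [projP hp p_surj]]] := projective_cover X.
by have [K [i sip]] := ses_ker hp p_surj; exists K, P, i, p.
Qed.

(** With the next lemma this compares the two computations of Ext^1(X, Y), by a projective
    presentation of [X] and by an injective one of [Y]. Lift [u] after [p] to w : P -> I. Then w
    maps [K] into [Y]; extending this restriction to s : P -> Y and subtracting it from w leaves a
    map that kills [K] and descends to [X]. *)
Lemma lift_of_extend K P X Y I Z (i : 'Hom(K, P)) (p : 'Hom(P, X))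
    (f : 'Hom(Y, I)) (g : 'Hom(I, Z)) :
  ses i p -> ses f g -> projective_mod P ->
  (forall u, u \in homv K Y ->
     exists2 v, v \in homv P Y & forall x, v (i x) = u x) ->
  forall u, u \in homv X Z ->
     exists2 v, v \in homv X I & forall x, g (v x) = u x.
Proof.
move=> sip sfg /projective_modP projP ext u hu.
have [hi hp] := (ses_homl sip, ses_homr sip).
have [hf hg] := (ses_homl sfg, ses_homr sfg).
have [w hw wE] := projP _ _ _ _ hg (homv_comp hu hp) (ses_surj sfg).
have wi x : exists y, (w \o i)%VF x = f y.
  by apply/(ses_exact sfg); rewrite comp_lfunE wE comp_lfunE (ses_comp0 _ sip) linear0.
have [t ht tE] := factor_mono hf (homv_comp hw hi) (ses_inj sfg) wi.
have [s hs sE] := ext t ht.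
have [|y|v hv vE] := @factor_epi _ _ _ _ _ p (w - (f \o s)%VF) hp _ (ses_surj sip).
- exact: homB hw (homv_comp hf hs).
- move=> /(ses_exact sip)[x ->]; rewrite add_lfunE opp_lfunE comp_lfunE sE tE.
  by rewrite comp_lfunE subrr.
exists v => // x; have [y ->] := ses_surj sip x.
rewrite vE add_lfunE opp_lfunE comp_lfunE linearB /= wE (ses_comp0 _ sfg).
by rewrite subr0 comp_lfunE.
Qed.

(** The dual argument: extend [f] after [u] to w : P -> I, lift the map X -> Z that it induces, and
    subtract; the difference takes values in [Y]. *)
Lemma extend_of_lift K P X Y I Z (i : 'Hom(K, P)) (p : 'Hom(P, X))
    (f : 'Hom(Y, I)) (g : 'Hom(I, Z)) :
  ses i p -> ses f g -> injective_mod I ->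
  (forall u, u \in homv X Z ->
     exists2 v, v \in homv X I & forall x, g (v x) = u x) ->
  forall u, u \in homv K Y ->
     exists2 v, v \in homv P Y & forall x, v (i x) = u x.
Proof.
move=> sip sfg /injective_modP injI lift u hu.
have [hi hp] := (ses_homl sip, ses_homr sip).
have [hf hg] := (ses_homl sfg, ses_homr sfg).
have [w hw wE] := injI _ _ _ _ hi (homv_comp hf hu) (ses_inj sip).
have gw y : p y = 0 -> (g \o w)%VF y = 0.
  move=> /(ses_exact sip)[x ->].
  by rewrite comp_lfunE wE comp_lfunE (ses_comp0 _ sfg).
have [t ht tE] := factor_epi hp (homv_comp hg hw) (ses_surj sip) gw.
have [s hs sE] := lift t ht.
have [|y|v hv vE] := @factor_mono _ _ _ _ _ f (w - (s \o p)%VF) hf _ (ses_inj sfg).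
- exact: homB hw (homv_comp hs hp).
- apply/(ses_exact sfg); rewrite add_lfunE opp_lfunE comp_lfunE linearB /= sE tE.
  by rewrite comp_lfunE subrr.
exists v => // x; apply: (ses_inj sfg).
rewrite vE add_lfunE opp_lfunE comp_lfunE wE (ses_comp0 _ sip) linear0 subr0.
by rewrite comp_lfunE.
Qed.

(** Quantifying over all injective presentations of [Y] avoids a choice; by [ext1_zero_of_lift] a
    single one is enough. *)
Definition ext1_zero X Y : Prop :=
  forall I Z (f : 'Hom(Y, I)) (g : 'Hom(I, Z)), ses f g -> injective_mod I ->
  forall u, u \in homv X Z ->
    exists2 v, v \in homv X I & forall x, g (v x) = u x.

Lemma ext1_zeroP K P X Y (i : 'Hom(K, P)) (p : 'Hom(P, X)) :
  ses i p -> projective_mod P ->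
  ext1_zero X Y <->
  forall u, u \in homv K Y ->
    exists2 v, v \in homv P Y & forall x, v (i x) = u x.
Proof.
move=> sip projP; split=> [E1|ext I Z f g sfg injI].
  have [I [Z [f [g [sfg injI]]]]] := ses_injective Y.
  exact: extend_of_lift sip sfg injI (E1 _ _ _ _ sfg injI).
exact: lift_of_extend sip sfg projP ext.
Qed.

Lemma ext1_zero_of_lift X Y I Z (f : 'Hom(Y, I)) (g : 'Hom(I, Z)) :
  ses f g -> injective_mod I ->
  (forall u, u \in homv X Z ->
     exists2 v, v \in homv X I & forall x, g (v x) = u x) ->
  ext1_zero X Y.
Proof.
move=> sfg injI lift; have [K [P [i [p [sip projP]]]]] := ses_projective X.
by apply/(ext1_zeroP _ sip projP); apply: extend_of_lift sip sfg injI lift.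
Qed.

(** The left side lets every map K -> Z lift to [I], the right side lets it extend to [P]. A lift to
    [I] extends to [P] as [I] is injective, and an extension to [P] lifts to [I] as [P] is
    projective. *)
Lemma ext1_zero_shift K P X Y I Z (i : 'Hom(K, P)) (p : 'Hom(P, X))
    (f : 'Hom(Y, I)) (g : 'Hom(I, Z)) :
  ses i p -> ses f g -> projective_mod P -> injective_mod I ->
  ext1_zero K Y <-> ext1_zero X Z.
Proof.
move=> sip sfg projP injI; split=> E1.
  apply/(ext1_zeroP _ sip projP) => u hu.
  have [v hv vE] := E1 _ _ _ _ sfg injI u hu.
  move/injective_modP: injI => /(_ _ _ _ _ (ses_homl sip) hv (ses_inj sip))[w hw wE].
  exists (g \o w)%VF => [|x]; first exact: homv_comp (ses_homr sfg) hw.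
  by rewrite comp_lfunE wE.
apply: (ext1_zero_of_lift sfg injI) => u hu.
have [v hv vE] := (ext1_zeroP _ sip projP).1 E1 u hu.
move/projective_modP: projP => /(_ _ _ _ _ (ses_homr sfg) hv (ses_surj sfg))[w hw wE].
exists (w \o i)%VF => [|x]; first exact: homv_comp hw (ses_homl sip).
by rewrite comp_lfunE wE.
Qed.

(* [ext_vanish j X Y] encodes the vanishing of Ext^(j+1)(X, Y) without
   choosing resolutions. *)
Fixpoint ext_vanish j X Y : Prop :=
  if j is i.+1 then
    forall I Z (f : 'Hom(Y, I)) (g : 'Hom(I, Z)),
      ses f g -> injective_mod I -> ext_vanish i X Z
  else ext1_zero X Y.

Lemma ext_vanish_syzygy j K P X Y (i : 'Hom(K, P)) (p : 'Hom(P, X)) :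
  ses i p -> projective_mod P -> ext_vanish j.+1 X Y <-> ext_vanish j K Y.
Proof.
move=> sip projP; elim: j Y => [|j IHj] Y /=; last first.
  by split=> E I Z f g sfg injI; apply/IHj; apply: E sfg injI.
split=> [E|E I Z f g sfg injI].
  have [I [Z [f [g [sfg injI]]]]] := ses_injective Y.
  exact/(ext1_zero_shift sip sfg)/(E _ _ _ _ sfg).
by apply/(ext1_zero_shift sip sfg).
Qed.

(** One injective presentation of [Y] suffices. The induction replaces [X] by its syzygy, which
    lowers the degree without touching the presentation of [Y]. *)
Lemma ext_vanish_cosyzygy j X Y I Z (f : 'Hom(Y, I)) (g : 'Hom(I, Z)) :
  ses f g -> injective_mod I -> ext_vanish j.+1 X Y <-> ext_vanish j X Z.
Proof.
move=> sfg injI; split=> [E|]; first exact: E sfg injI.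
elim: j X => [|j IHj] X E; have [K [P [i [p [sip projP]]]]] := ses_projective X.
  exact/(ext_vanish_syzygy 0 _ sip projP)/(ext1_zero_shift sip sfg projP injI).
by apply/(ext_vanish_syzygy _ _ sip projP)/IHj/(ext_vanish_syzygy _ _ sip projP).
Qed.

Lemma ext_vanish_summandl j M X Y :
  ext_vanish j M Y -> summand M X -> ext_vanish j X Y.
Proof.
elim: j Y => [|j IHj] Y E MX; last first.
  by move=> I Z f g sfg injI; apply: IHj MX; apply: E sfg injI.
move=> I Z f g sfg injI u hu; have [n [s [r [hs hr rs]]]] := MX.
have /choice[v vE] j :
    exists v, v \in homv M I /\ forall x, g (v x) = u (r j x).
  have [v hv vE] := E _ _ _ _ sfg injI _ (homv_comp hu (hr j)).
  by exists v; split=> // x; rewrite vE comp_lfunE.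
exists (\sum_j (v j \o s j)%VF).
  by apply: hom_sum => j; apply: homv_comp (hs j); case: (vE j).
move=> x; rewrite sum_lfunE linear_sum -[in RHS](rs x) linear_sum.
by apply: eq_bigr => j _; rewrite comp_lfunE /=; case: (vE j) => _ ->.
Qed.

Lemma ext_vanish_summandr j M X Y :
  ext_vanish j X M -> summand M Y -> ext_vanish j X Y.
Proof.
move=> E MY; elim: j X E => [|j IHj] X E;
  have [K [P [i [p [sip projP]]]]] := ses_projective X; last first.
  by apply/(ext_vanish_syzygy _ _ sip projP)/IHj/(ext_vanish_syzygy _ _ sip projP).
apply/(ext1_zeroP _ sip projP) => u hu; have [n [s [r [hs hr rs]]]] := MY.
have /choice[v vE] j :
    exists v, v \in homv P M /\ forall x, v (i x) = s j (u x).
  have [v hv vE] := (ext1_zeroP _ sip projP).1 E _ (homv_comp (hs j) hu).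
  by exists v; split=> // x; rewrite vE comp_lfunE.
exists (\sum_j (r j \o v j)%VF).
  by apply: hom_sum => j; apply: homv_comp (hr j) _; case: (vE j).
move=> x; rewrite sum_lfunE -[in RHS](rs (u x)).
by apply: eq_bigr => j _; rewrite comp_lfunE; case: (vE j) => _ ->.
Qed.

Lemma ext_vanish_dsuml j X X' Y :
  ext_vanish j X Y -> ext_vanish j X' Y -> ext_vanish j (dsum X X') Y.
Proof.
elim: j Y => [|j IHj] Y E E'; last first.
  by move=> I Z f g sfg injI; apply: IHj; [apply: E sfg injI | apply: E' sfg injI].
move=> I Z f g sfg injI u hu.
have [||i hi iE] := @hom_of _ _ X (dsum X X') (fun x => (x, 0)).
- by move=> c x y; rewrite -[RHS]/(c *: x + y, c *: 0 + 0) scaler0 addr0.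
- by move=> a x; rewrite /= /dsum_act /= linear0.
have [||i' hi' i'E] := @hom_of _ _ X' (dsum X X') (fun x => (0, x)).
- by move=> c x y; rewrite -[RHS]/(c *: 0 + 0, c *: x + y) scaler0 addr0.
- by move=> a x; rewrite /= /dsum_act /= linear0.
have [v hv vE] := E _ _ _ _ sfg injI _ (homv_comp hu hi).
have [v' hv' v'E] := E' _ _ _ _ sfg injI _ (homv_comp hu hi').
have [||w hw wE] := @hom_of _ _ (dsum X X') I (fun z => v z.1 + v' z.2).
- by move=> c x y; rewrite /= !linearP scalerDr addrACA.
- by move=> a x; rewrite /= !hom_act // linearD.
exists w => // -[x x']; rewrite wE /= linearD /= vE v'E !comp_lfunE iE i'E -linearD.
by congr (u _); rewrite -[LHS]/(x + 0, 0 + x') addr0 add0r.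
Qed.

Lemma ext_vanish_dsumr j X Y Y' :
  ext_vanish j X Y -> ext_vanish j X Y' -> ext_vanish j X (dsum Y Y').
Proof.
elim: j X => [|j IHj] X; have [K [P [i [p [sip projP]]]]] := ses_projective X; last first.
  move=> /(ext_vanish_syzygy _ _ sip projP) E /(ext_vanish_syzygy _ _ sip projP) E'.
  exact/(ext_vanish_syzygy _ _ sip projP)/IHj.
move=> /(ext1_zeroP _ sip projP) E /(ext1_zeroP _ sip projP) E'.
apply/(ext1_zeroP _ sip projP) => u hu.
have [||q hq qE] := @hom_of _ _ (dsum Y Y') Y fst; try by [].
have [||q' hq' q'E] := @hom_of _ _ (dsum Y Y') Y' snd; try by [].
have [v hv vE] := E _ (homv_comp hq hu).
have [v' hv' v'E] := E' _ (homv_comp hq' hu).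
have [||w hw wE] := @hom_of _ _ P (dsum Y Y') (fun x => (v x, v' x)).
- by move=> c x y; rewrite !linearP.
- by move=> a x; rewrite !hom_act.
exists w => // x; rewrite wE vE v'E !comp_lfunE qE q'E.
by case: (u x).
Qed.

Lemma ext_vanish_projective j P Y : projective_mod P -> ext_vanish j P Y.
Proof.
move=> projP; elim: j Y => [|j IHj] Y I Z f g sfg injI; last exact: IHj.
move=> u hu; move/projective_modP: projP; apply=> //.
  exact: ses_homr sfg.
exact: ses_surj sfg.
Qed.

Lemma ext_vanish_injective j X I : injective_mod I -> ext_vanish j X I.
Proof.
move=> injI; elim: j X => [|j IHj] X;
  have [K [P [i [p [sip projP]]]]] := ses_projective X; last first.
  exact/(ext_vanish_syzygy _ _ sip projP).
apply/(ext1_zeroP _ sip projP) => u hu.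
move/injective_modP: injI; apply=> //; [exact: ses_homl sip | exact: ses_inj sip].
Qed.

(** The identity of [Z] lifts to [I], so the sequence splits and [X] is a summand of [I]. *)
Lemma injective_of_split X I Z (f : 'Hom(X, I)) (g : 'Hom(I, Z)) :
  ses f g -> injective_mod I -> ext1_zero Z X -> injective_mod X.
Proof.
move=> sfg injI E; have [s hs sE] := E _ _ _ _ sfg injI _ (homv_id Z).
have [hf hg] := (ses_homl sfg, ses_homr sfg).
have [|x|r hr rE] :=
    @factor_mono _ _ _ _ _ f (\1 - (s \o g))%VF hf _ (ses_inj sfg).
- exact: homB (homv_id _) (homv_comp hs hg).
- apply/(ses_exact sfg); rewrite add_lfunE opp_lfunE comp_lfunE linearB /= sE.
  by rewrite !id_lfunE subrr.
apply: injective_summand injI _; apply: summand1 hf hr _ => y.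
apply: (ses_inj sfg); rewrite rE add_lfunE opp_lfunE comp_lfunE (ses_comp0 _ sfg).
by rewrite linear0 subr0 id_lfunE.
Qed.

Lemma injective_of_ext1_zero Y : (forall X, ext1_zero X Y) -> injective_mod Y.
Proof.
move=> E; have [I [Z [f [g [sfg injI]]]]] := ses_injective Y.
exact: injective_of_split sfg injI (E Z).
Qed.

End ExtVanishing.

(** * Resolutions *)

Section Resolutions.
Local Open Scope ring_scope.
Context {k : fieldType} {A : falgType k}.
Implicit Types M N L X Y Z Q K C : fdmod A.

Lemma projective_resolution_tail X (P : nat -> fdmod A) (e : 'Hom(P 0%N, X))
    (d : forall i, 'Hom(P i.+1, P i)) : projective_resolution e d ->
  exists K (i : 'Hom(K, P 0%N)) (q : 'Hom(P 1%N, K)),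
    [/\ ses i e, forall x, d 0%N x = i (q x)
      & @projective_resolution _ _ K (fun n => P n.+1) q (fun n => d n.+1)].
Proof.
case=> projP he hd e_surj ex0 ex.
have [K [i [hi i_inj iE]]] := submod_exists (lker_submod he).
have [x|q hq qE] := factor_mono hi (hd 0%N) i_inj.
  by apply/limgP; rewrite iE -ex0; apply/limgP; exists x.
exists K, i, q; split=> //.
  split=> // [y|]; last exact/limgTP.
  by rewrite -limgP iE memv_ker; split=> /eqP.
split=> [n||n|||n]; [exact: projP| |exact: hd| | |exact: ex] => //.
  apply/limgTP=> y; have : i y \in limg (d 0%N).
    by rewrite ex0 -iE; apply/limgP; exists y.
  by case/limgP=> x /eqP; rewrite -qE => /eqP/i_inj->; exists x.
rewrite ex; apply/vspaceP=> x; rewrite !memv_ker -qE.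
by apply/eqP/eqP=> [|->]; rewrite ?linear0 // -[in X in X -> _](linear0 i) => /i_inj.
Qed.

Lemma injective_resolution_tail X (I : nat -> fdmod A) (e : 'Hom(X, I 0%N))
    (d : forall i, 'Hom(I i, I i.+1)) : injective_resolution e d ->
  exists Z (p : 'Hom(I 0%N, Z)) (i : 'Hom(Z, I 1%N)),
    [/\ ses e p, forall x, d 0%N x = i (p x)
      & @injective_resolution _ _ Z (fun n => I n.+1) i (fun n => d n.+1)].
Proof.
case=> injI he hd e_inj ex0 ex.
have [Z [i [hi i_inj iE]]] := submod_exists (limg_submod (hd 0%N)).
have [x|p hp pE] := factor_mono hi (hd 0%N) i_inj.
  by apply/limgP; rewrite iE; apply/limgP; exists x.
exists Z, p, i; split=> //.
  split=> // [|y|z]; first exact/lker0I.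
    rewrite -limgP ex0 memv_ker -pE; split=> [->|]; first by rewrite linear0.
    by move/eqP; rewrite -[X in _ = X](linear0 i) => /i_inj.
  have : i z \in limg (d 0%N) by rewrite -iE; apply/limgP; exists z.
  by case/limgP=> y; rewrite -pE => /i_inj->; exists y.
split=> [n||n|||n]; [exact: injI| |exact: hd|exact/lker0I| |exact: ex] => //.
by rewrite iE ex.
Qed.

(** Dropping the first term of the resolution lowers the cochain degree by one and replaces [X] by
    its syzygy, so only degree 1 remains to be compared. *)
Lemma ext_vanish_resolution j X Y (P : nat -> fdmod A) (e : 'Hom(P 0%N, X))
    (d : forall i, 'Hom(P i.+1, P i)) : projective_resolution e d ->
  (ext_cocycles d Y j.+1 <= ext_coboundaries d Y j.+1)%VS <-> ext_vanish j X Y.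
Proof.
elim: j X P e d => [|j IHj] X P e d res;
  have [K [i [q [sie dE tail]]]] := projective_resolution_tail res; last first.
  apply: (iff_trans _ (iff_sym (ext_vanish_syzygy _ _ sie (@pres_proj _ _ _ _ _ _ res 0)))).
  exact: IHj tail.
apply: (iff_trans _ (iff_sym (ext1_zeroP _ sie (@pres_proj _ _ _ _ _ _ res 0)))).
have [hq hi] := (pres_hom0 tail, ses_homl sie).
have q_surj := (limgTP _).1 (pres_surj tail).
(* A 1-cocycle vanishes on the image of [d 1], the kernel of [q], hence has the form [u] after [q];
   it is a coboundary exactly when [u] extends along [i]. *)
split=> [/subvP cocyc u hu|ext].
  have /cocyc : (u \o q)%VF \in ext_cocycles d Y 1.
    rewrite memv_cap homv_comp //= memv_ker ext_diffE; apply/eqP/lfunP=> x.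
    rewrite !comp_lfunE zero_lfunE; apply/eqP; rewrite -memv_ker.
    have /eqP -> : q (d 1%N x) == 0.
      by rewrite -memv_ker -(pres_exact0 tail); apply/limgP; exists x.
    by rewrite mem0v.
  case/memv_imgP=> v hv; rewrite ext_diffE => uE; exists v => // y.
  have [x ->] := q_surj y.
  by rewrite -dE -[RHS]comp_lfunE uE comp_lfunE.
apply/subvP=> f /memv_capP[hf]; rewrite memv_ker ext_diffE => /eqP/lfunP f0.
have [x|t ht tE] := factor_epi hq hf q_surj.
  move=> /eqP; rewrite -memv_ker -(pres_exact0 tail) => /limgP[y ->].
  by have := f0 y; rewrite comp_lfunE zero_lfunE.
have [v hv vE] := ext t ht; apply/memv_imgP; exists v => //.
by rewrite ext_diffE; apply/lfunP=> x; rewrite comp_lfunE dE vE tE.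
Qed.

(** The data are bundled so that one presentation can be chosen for every module and the choice
    iterated into a resolution. *)
Record projective_presentation X := ProjectivePresentation {
  pp_ker : fdmod A;
  pp_mod : fdmod A;
  pp_inj : 'Hom(pp_ker, pp_mod);
  pp_proj : 'Hom(pp_mod, X);
  pp_ses : ses pp_inj pp_proj;
  pp_projective : projective_mod pp_mod
}.

Lemma projective_presentation_exists X :
  exists p : projective_presentation X, True.
Proof.
have [K [P [i [p [sip projP]]]]] := ses_projective X.
by exists (ProjectivePresentation sip projP).
Qed.

Lemma projective_resolution_exists X :
  exists (P : nat -> fdmod A) (e : 'Hom(P 0%N, X)) (d : forall i, 'Hom(P i.+1, P i)),
    projective_resolution e d.
Proof.
pose pp Y := sval (cid (projective_presentation_exists Y)).
pose fix syz n := if n is m.+1 then pp_ker (pp (syz m)) else X.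
pose P n := pp_mod (pp (syz n)).
pose i n : 'Hom(syz n.+1, P n) := pp_inj (pp (syz n)).
pose p n : 'Hom(P n, syz n) := pp_proj (pp (syz n)).
have s n : ses (i n) (p n) by exact: pp_ses.
have limd n : limg (i n \o p n.+1)%VF = lker (p n).
  apply/vspaceP=> y; rewrite memv_ker; apply/idP/eqP=> [/limgP[x ->]|].
    by rewrite comp_lfunE (ses_comp0 _ (s n)).
  move=> /(ses_exact (s n))[x ->]; have [z ->] := ses_surj (s n.+1) x.
  by apply/limgP; exists z; rewrite comp_lfunE.
exists P, (p 0%N), (fun n => i n \o p n.+1)%VF; split=> [n||n|||n].
- exact: pp_projective.
- exact: ses_homr (s 0%N).
- exact: homv_comp (ses_homl (s n)) (ses_homr (s n.+1)).
- exact/limgTP/(ses_surj (s 0%N)).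
- exact: limd.
rewrite limd; apply/vspaceP=> y; rewrite !memv_ker comp_lfunE.
apply/eqP/eqP=> [->|]; first by rewrite linear0.
by rewrite -[X in _ = X -> _](linear0 (i n)) => /(ses_inj (s n)).
Qed.

Lemma ext_zeroP j X Y : ext_zero j.+1 X Y <-> ext_vanish j X Y.
Proof.
split=> [[P [e [d [res cocyc]]]]|E]; first exact/(ext_vanish_resolution _ _ res).
have [P [e [d res]]] := projective_resolution_exists X.
by exists P, e, d; split=> //; apply/(ext_vanish_resolution _ _ res).
Qed.

Lemma ext_vanish_projdim n X Y (P : nat -> fdmod A) (e : 'Hom(P 0%N, X))
    (d : forall i, 'Hom(P i.+1, P i)) : projective_resolution e d ->
  (forall i, (n < i)%N -> \dim {:P i} = 0%N) -> ext_vanish n X Y.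
Proof.
elim: n X P e d => [|n IHn] X P e d res P0;
  have [K [i [q [sie dE tail]]]] := projective_resolution_tail res; last first.
  apply/(ext_vanish_syzygy _ _ sie (@pres_proj _ _ _ _ _ _ res 0)).
  by apply: IHn tail _ => l nl; apply: P0.
apply/(ext1_zeroP _ sie (@pres_proj _ _ _ _ _ _ res 0)) => u hu.
exists 0 => [|x]; first exact: mem0v.
have [y ->] := (limgTP _).1 (pres_surj tail) x.
by rewrite ((dimv_fullv0 _).1 (P0 1%N isT) y) !linear0.
Qed.

(** By induction on the length the first cosyzygy [Z] is injective, and then the vanishing
    hypothesis applies to [Z] itself and splits the first sequence. This is why vanishing is needed
    against injective modules only. *)
Lemma injective_of_injdim n X (I : nat -> fdmod A) (e : 'Hom(X, I 0%N))
    (d : forall i, 'Hom(I i, I i.+1)) : injective_resolution e d ->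
  (forall i, (n < i)%N -> \dim {:I i} = 0%N) ->
  (forall j J, (j < n)%N -> injective_mod J -> ext_vanish j J X) ->
  injective_mod X.
Proof.
elim: n X I e d => [|n IHn] X I e d res I0 E;
  have [Z [p [i [sep dE tail]]]] := injective_resolution_tail res;
  have injI := @ires_inj _ _ _ _ _ _ res 0; last first.
  have injZ : injective_mod Z.
    apply: IHn tail _ _ => [l nl|j J jn injJ]; first exact: I0.
    exact/(ext_vanish_cosyzygy _ _ sep injI)/E.
  exact: injective_of_split sep injI (E 0%N Z isT injZ).
apply: injective_of_split sep injI _ => J W f g sfg injJ u hu.
have Z0 (z : Z) : z = 0.
  apply: ((lker0I _).1 (ires_mono tail)).
  by rewrite ((dimv_fullv0 _).1 (I0 1%N isT) (i z)) linear0.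
exists 0 => [|z]; first exact: mem0v.
by rewrite zero_lfunE [z]Z0 !linear0.
Qed.

End Resolutions.

(** * Injective envelopes and minimal resolutions *)

Section MinimalResolutions.
Local Open Scope ring_scope.
Context {k : fieldType} {A : falgType k}.
Implicit Types M N L X Y Z I J U Q K C B W : fdmod A.

Lemma endo_inverse U (f : 'Hom(U, U)) : f \in homv U U -> injective f ->
  exists2 g : 'Hom(U, U), g \in homv U U & forall x, g (f x) = x.
Proof.
move=> hf f_inj; have f_surj y : exists x, \1%VF y = f x.
  by exists (f^-1%VF y); rewrite lker0_lfunVK ?id_lfunE //; apply/lker0P.
have [g hg fg] := factor_mono hf (homv_id U) f_inj f_surj.
by exists g => // x; apply: f_inj; rewrite fg id_lfunE.
Qed.

(** The kernel of [h] is a submodule meeting the image of [f] in zero. *)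
Lemma essential_injective X I J (f : 'Hom(X, I)) (h : 'Hom(I, J)) :
  essentialv (limg f) -> h \in homv I J -> injective (h \o f)%VF -> injective h.
Proof.
move=> ess hh hf_inj; apply/lker0I/ess; first exact: lker_submod.
apply/eqP; rewrite -subv0; apply/subvP=> _ /memv_capP[/limgP[x ->]].
rewrite memv_ker => /eqP hfx; have -> : x = 0.
  by apply: hf_inj; rewrite comp_lfunE hfx linear0.
by rewrite linear0 mem0v.
Qed.

(* An injective envelope is the image of an endomorphism h of minimal rank,
   among those fixing X, of an injective module containing X: composing h with
   another such endomorphism cannot lower the rank. *)
Lemma injective_envelope X :
  exists I Z (f : 'Hom(X, I)) (g : 'Hom(I, Z)),
    [/\ ses f g, injective_mod I & essentialv (limg f)].
Proof.
have [J [j [injJ hj j_inj]]] := injective_embedding X.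
pose fixes (h : 'Hom(J, J)) := h \in homv J J /\ forall x, h (j x) = j x.
have exn : exists n, `[< exists2 h, fixes h & \dim (limg h) = n >].
  exists (\dim (limg (\1%VF : 'Hom(J, J)))); apply/asboolP; exists \1%VF => //.
  by split=> [|x]; [exact: homv_id | rewrite id_lfunE].
case: (ex_minnP exn) => n /asboolP[h [hh hj_id] dimh] min_h.
have cap0 g : fixes g -> (limg h :&: lker g = 0)%VS.
  move=> [hg gj]; apply/eqP; rewrite -dimv_eq0 -leqn0 -(leq_add2r (\dim (g @: limg h))).
  rewrite limg_ker_dim add0n dimh -limg_comp; apply/min_h/asboolP.
  exists (g \o h)%VF => //; split=> [|x]; first exact: homv_comp.
  by rewrite comp_lfunE hj_id gj.
have [U [u [hu u_inj uE]]] := submod_exists (limg_submod hh).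
have u0 g y : fixes g -> g (u y) = 0 -> y = 0.
  move=> /cap0 c0 guy; apply: u_inj; rewrite linear0; apply/eqP.
  by rewrite -memv0 -c0 memv_cap memv_ker guy eqxx -uE memv_img ?memvf.
have [x|q hq qE] := factor_mono hu hh u_inj.
  by apply/limgP; rewrite uE memv_img ?memvf.
have [x|f hf fE] := factor_mono hu hj u_inj.
  by apply/limgP; rewrite uE -hj_id memv_img ?memvf.
have qu_inj : injective (q \o u)%VF.
  apply: lfun_inj => y; rewrite comp_lfunE => quy.
  by apply: (u0 h) => //; rewrite -qE quy linear0.
have [v hv vE] := endo_inverse (homv_comp hq hu) qu_inj.
have injU : injective_mod U.
  apply: injective_summand injJ (summand1 hu (homv_comp hv hq) _) => x.
  by rewrite comp_lfunE -[RHS]vE comp_lfunE.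
have f_inj : injective f by move=> x y fxy; apply: j_inj; rewrite -!fE fxy.
have [Z [g sfg]] := ses_coker hf f_inj; exists U, Z, f, g; split=> // W subW capW.
(* For essentiality, let [W] meet the image of [X] trivially. Then the sum of [X] and [W] embeds in
   [J], and the map that is [j] on [X] and zero on [W] extends to an endomorphism fixing [X]. Such
   an endomorphism is injective on [U], so [W] is zero. *)
have [K [w [hw w_inj wE]]] := submod_exists subW.
have [||phi hphi phiE] := @hom_of _ _ (dsum X K) J (fun z => j z.1 + u (w z.2)).
- by move=> c x y; rewrite /= !linearP scalerDr addrACA.
- by move=> a x; rewrite /= !hom_act // linearD.
have [||psi hpsi psiE] := @hom_of _ _ (dsum X K) J (fun z => j z.1).
- by move=> c x y; rewrite /= !linearP.
- by move=> a x; rewrite /= hom_act.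
have phi_inj : injective phi.
  apply: lfun_inj => -[x y]; rewrite phiE /= -fE -linearD => uxy.
  have /eqP : f x + w y = 0 by apply: u_inj; rewrite uxy linear0.
  rewrite addr_eq0 => /eqP fx.
  have : f x \in (limg f :&: W)%VS.
    by rewrite memv_cap memv_img ?memvf // fx -wE memvN memv_img ?memvf.
  rewrite capW memv0 => /eqP fx0.
  have -> : x = 0 by apply: f_inj; rewrite linear0.
  have -> // : y = 0.
  by apply: w_inj; rewrite linear0; apply/eqP; rewrite -oppr_eq0 -fx fx0.
move/injective_modP: injJ => /(_ _ _ _ _ hphi hpsi phi_inj)[g' hg' g'E].
have fix_g' : fixes g'.
  split=> // x; have := g'E (x, 0).
  by rewrite phiE psiE /= !linear0 addr0.
apply/eqP; rewrite -subv0; apply/subvP=> y; rewrite -wE => /limgP[z ->].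
rewrite memv0; apply/eqP/(u0 _ _ fix_g').
by have := g'E (0, z); rewrite phiE psiE /= !linear0 add0r.
Qed.

Record envelope X := Envelope {
  env_mod : fdmod A;
  env_coker : fdmod A;
  env_in : 'Hom(X, env_mod);
  env_out : 'Hom(env_mod, env_coker);
  env_ses : ses env_in env_out;
  env_injective : injective_mod env_mod;
  env_essential : essentialv (limg env_in)
}.

Lemma envelope_exists X : exists e : envelope X, True.
Proof.
have [I [Z [f [g [sfg injI ess]]]]] := injective_envelope X.
by exists (Envelope sfg injI ess).
Qed.

Definition env X : envelope X := sval (cid (envelope_exists X)).

Fixpoint cosyzygy X n := if n is m.+1 then env_coker (env (cosyzygy X m)) else X.

Definition min_inj X n := env_mod (env (cosyzygy X n)).

Definition min_in X n : 'Hom(cosyzygy X n, min_inj X n) := env_in (env (cosyzygy X n)).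

Definition min_out X n : 'Hom(min_inj X n, cosyzygy X n.+1) :=
  env_out (env (cosyzygy X n)).

Definition min_diff X n : 'Hom(min_inj X n, min_inj X n.+1) :=
  (min_in X n.+1 \o min_out X n)%VF.

Lemma min_ses X n : ses (min_in X n) (min_out X n).
Proof. exact: env_ses. Qed.

Lemma min_injective X n : injective_mod (min_inj X n).
Proof. exact: env_injective. Qed.

Lemma min_essential X n : essentialv (limg (min_in X n)).
Proof. exact: env_essential. Qed.

Lemma limg_min_diff X n : limg (min_diff X n) = limg (min_in X n.+1).
Proof.
apply/vspaceP=> y; apply/idP/idP=> /limgP[x ->]; apply/limgP.
  by exists (min_out X n x); rewrite comp_lfunE.
by have [z ->] := ses_surj (min_ses X n) x; exists z; rewrite comp_lfunE.
Qed.

Lemma lker_min_diff X n : lker (min_diff X n) = limg (min_in X n).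
Proof.
apply/vspaceP=> y; rewrite memv_ker comp_lfunE.
apply/eqP/idP=> [|/limgP/(ses_exact (min_ses X n))->]; last by rewrite linear0.
rewrite -[X in _ = X](linear0 (min_in X n.+1)) => /(ses_inj (min_ses X n.+1)).
by move/(ses_exact (min_ses X n))/limgP.
Qed.

Lemma min_resolution X : minimal_injective_resolution (min_in X 0) (min_diff X).
Proof.
split=> [||n]; first split=> [n||n|||n].
- exact: min_injective.
- exact: ses_homl (min_ses X 0).
- exact: homv_comp (ses_homl (min_ses X n.+1)) (ses_homr (min_ses X n)).
- exact/lker0I/(ses_inj (min_ses X 0)).
- by rewrite lker_min_diff.
- by rewrite lker_min_diff limg_min_diff.
- exact: min_essential.
- by rewrite limg_min_diff; apply: min_essential.
Qed.

Lemma ext_vanish_min n m X Y :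
  ext_vanish (n + m) X Y <-> ext_vanish m X (cosyzygy Y n).
Proof.
elim: n m => [|n IHn] m //; rewrite addSnnS IHn.
exact: ext_vanish_cosyzygy (min_ses Y n) (@min_injective Y n).
Qed.

(** An injective module equals its envelope: a retraction of the embedding is injective by
    essentiality. Hence the next cosyzygy is zero, and so is everything after it. *)
Lemma min_stop X n i : injective_mod (cosyzygy X n) -> (n < i)%N ->
  \dim {:min_inj X i} = 0%N.
Proof.
move=> injZ.
have coker0 m : injective_mod (cosyzygy X m) -> forall z : cosyzygy X m.+1, z = 0.
  move=> injm z; have s := min_ses X m.
  move/injective_modP: injm => /(_ _ _ _ _ (ses_homl s) (homv_id _) (ses_inj s))[r hr rE].
  have r_inj : injective r.
    apply: (essential_injective (@min_essential X m) hr).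
    by apply: lfun_inj => x; rewrite comp_lfunE rE id_lfunE.
  have [y ->] := ses_surj s z; apply/(ses_exact s); exists (r y).
  by apply: r_inj; rewrite rE id_lfunE.
have inj0 m : (forall z : cosyzygy X m, z = 0) -> injective_mod (cosyzygy X m).
  move=> Z0; apply/injective_modP=> N L g f _ _ _; exists 0 => [|x]; first exact: mem0v.
  by rewrite zero_lfunE [f x]Z0.
elim: i => // i IHi; rewrite ltnS leq_eqVlt => ni.
have Z0 : forall z : cosyzygy X i.+1, z = 0.
  apply: coker0; case/predU1P: ni => [<- //|ni].
  have I0 := (dimv_fullv0 _).1 (IHi ni).
  apply: inj0 => z; apply: (ses_inj (min_ses X i)).
  by rewrite [LHS]I0 [RHS]I0.
apply/dimv_fullv0 => x; apply/eqP; rewrite -memv0.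
(* The image of a zero cosyzygy is the zero submodule; being essential, it forces the whole term to
   vanish. *)
have {}/capv_idPr : (limg (min_in X i.+1) <= 0)%VS.
  by apply/subvP=> _ /limgP[z ->]; rewrite [z]Z0 linear0 mem0v.
rewrite cap0v => lim0.
have := @min_essential X i.+1 fullv; rewrite -lim0 cap0v => <- //; first exact: memvf.
by move=> a y _; apply: memvf.
Qed.

Lemma injdim_le n X : injective_mod (cosyzygy X n) -> (injdim X <= Fin n)%enat.
Proof.
move=> injZ; rewrite /injdim /einf; case: pselect => [ex|[]].
  case: ex_minnP => m _; apply; apply/asboolP.
  exists (min_inj X), (min_in X 0), (min_diff X); split=> [|i ni].
    by case: (min_resolution X).
  exact: min_stop injZ ni.
exists n; apply/asboolP; exists (min_inj X), (min_in X 0), (min_diff X).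
by split=> [|i ni]; [case: (min_resolution X) | exact: min_stop injZ ni].
Qed.

(** Dominant dimension at least [t], witnessed by a coresolution with [t] projective-injective terms
    that need not be minimal. *)
Fixpoint domdim_ge t Z : Prop :=
  if t is s.+1 then
    exists Q C (f : 'Hom(Z, Q)) (g : 'Hom(Q, C)),
      [/\ ses f g, projective_mod Q, injective_mod Q & domdim_ge s C]
  else True.

(** A direct summand of a single copy, the relation kept between the cosyzygies of a minimal
    resolution and those of an arbitrary coresolution. *)
Definition retract X Y : Prop :=
  exists (a : 'Hom(X, Y)) (b : 'Hom(Y, X)),
    [/\ a \in homv X Y, b \in homv Y X & forall x, b (a x) = x].

(** Extending the maps between [X] and [Y] gives u : I -> Q and r : Q -> I whose composite fixes
    [X], hence is an automorphism of the envelope [I]. So [I] is a summand of [Q], and the splitting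
    induces one on the cokernels. *)
Lemma domdim_ge_envelope t Y X I Z (i : 'Hom(X, I)) (p : 'Hom(I, Z)) :
  domdim_ge t.+1 Y -> retract X Y ->
  ses i p -> injective_mod I -> essentialv (limg i) ->
  projective_mod I /\ exists2 C, domdim_ge t C & retract Z C.
Proof.
move=> [Q [C [f [g [sfg projQ injQ dC]]]]] [a [b [ha hb baE]]] sip injI ess.
have [hi hp] := (ses_homl sip, ses_homr sip).
have [hf hg] := (ses_homl sfg, ses_homr sfg).
move/injective_modP: injQ => /(_ _ _ _ _ hi (homv_comp hf ha) (ses_inj sip))[u hu uE].
move/injective_modP: injI => /(_ _ _ _ _ hf (homv_comp hi hb) (ses_inj sfg))[r hr rE].
have ruE x : r (u (i x)) = i x by rewrite uE comp_lfunE rE comp_lfunE baE.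
have ru_inj : injective (r \o u)%VF.
  apply: (essential_injective ess); first exact: homv_comp.
  by move=> x y; rewrite !comp_lfunE !ruE => /(ses_inj sip).
have [t' ht t'E] := endo_inverse (homv_comp hr hu) ru_inj.
pose s := (t' \o r)%VF; have hs : s \in homv Q I by exact: homv_comp.
have suE x : s (u x) = x by rewrite -[RHS]t'E !comp_lfunE.
(* The inverse [t'] also fixes the image of [X]; this makes the corrected retraction [s] still
   compatible with [b], so that it descends to [C]. *)
have sfE y : s (f y) = i (b y).
  by rewrite comp_lfunE rE comp_lfunE -[in LHS]ruE -[RHS]t'E comp_lfunE.
split; first exact: projective_summand projQ (summand1 hu hs suE).
have [y /(ses_exact sip)[x ->]|a' ha' a'E] :=
    factor_epi hp (homv_comp hg hu) (ses_surj sip).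
  by rewrite comp_lfunE uE comp_lfunE (ses_comp0 _ sfg).
have [y /(ses_exact sfg)[x ->]|b' hb' b'E] :=
    factor_epi hg (homv_comp hp hs) (ses_surj sfg).
  by rewrite comp_lfunE sfE (ses_comp0 _ sip).
exists C => //; exists a', b'; split=> // z; have [y ->] := ses_surj sip z.
by rewrite a'E comp_lfunE b'E comp_lfunE suE.
Qed.

Lemma min_projective t X Y i : domdim_ge t Y -> retract X Y -> (i < t)%N ->
  projective_mod (min_inj X i).
Proof.
move=> dY XY; have IH m : (m <= t)%N ->
    exists2 C, domdim_ge (t - m) C & retract (cosyzygy X m) C.
  elim: m => [_|m IHm mt]; first by rewrite subn0; exists Y.
  have [C] := IHm (ltnW mt); rewrite -(subnSK mt) => dC CX.
  by have [] := domdim_ge_envelope dC CX (min_ses X m) (@min_injective X m)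
    (@min_essential X m).
move=> it; have [C] := IH _ (ltnW it); rewrite -(subnSK it) => dC CX.
by have [] := domdim_ge_envelope dC CX (min_ses X i) (@min_injective X i)
  (@min_essential X i).
Qed.

End MinimalResolutions.

(** * Modules of homomorphisms *)

Section HomModules.
Local Open Scope ring_scope.
Context {k : fieldType} {A B : falgType k}.

(** A second left action on [V] by A-endomorphisms. It turns Hom_A(X, V) into a left B-module by
    postcomposition, so both dualities below, Hom_A(-, M) and Hom_E(-, M), are instances of one
    construction between left modules. *)
Record commuting_action (V : fdmod A) := CommutingAction {
  rho :> B -> 'Hom(V, V);
  rho_linear : linear rho;
  rho_hom : forall b, rho b \in homv V V;
  rho1 : rho 1 = \1%VF;
  rhoM : forall b c, rho (b * c) = (rho b \o rho c)%VF
}.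

Variables (V : fdmod A) (r : commuting_action V).
Implicit Types X Y Z : fdmod A.

Section HomModule.
Variable X : fdmod A.

Definition hommod_act (b : B) (f : subvs_of (homv X V)) : subvs_of (homv X V) :=
  Subvs (homv_comp (rho_hom r b) (subvsP f)).

Fact hommod_linearl f : linear (hommod_act^~ f).
Proof.
move=> c a b; apply: val_inj; rewrite /= rho_linear.
by rewrite comp_lfunDl -comp_lfunZl.
Qed.

Fact hommod_linearr b : linear (hommod_act b).
Proof.
by move=> c f g; apply: val_inj; rewrite /= comp_lfunDr -comp_lfunZr.
Qed.

Fact hommod_act1 f : hommod_act 1 f = f.
Proof. by apply: val_inj; rewrite /= rho1 comp_lfun1l. Qed.

Fact hommod_actM a b f : hommod_act (a * b) f = hommod_act a (hommod_act b f).
Proof. by apply: val_inj; rewrite /= rhoM comp_lfunA. Qed.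

Definition hommod : fdmod B :=
  FDMod hommod_linearl hommod_linearr hommod_act1 hommod_actM.

Definition hval (f : hommod) : 'Hom(X, V) := vsval (f : subvs_of (homv X V)).

Lemma hvalP f : hval f \in homv X V. Proof. exact: subvsP. Qed.

Lemma hval_act b f x : hval (act b f) x = r b (hval f x).
Proof. exact: comp_lfunE. Qed.

Lemma hval_linear c (f g : hommod) x : hval (c *: f + g) x = c *: hval f x + hval g x.
Proof. by rewrite -scale_lfunE -add_lfunE. Qed.

Lemma hval_inj (f g : hommod) : (forall x, hval f x = hval g x) -> f = g.
Proof. by move=> /lfunP; apply: val_inj. Qed.

Lemma hvalK (f : 'Hom(X, V)) : f \in homv X V -> exists g, hval g = f.
Proof. by move=> hf; exists (Subvs hf). Qed.

End HomModule.

Lemma hom_to_hommod X (W : fdmod B) (F : W -> X -> V) :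
  (forall w, linear (F w)) -> (forall w a x, F w (act a x) = act a (F w x)) ->
  (forall c w w' x, F (c *: w + w') x = c *: F w x + F w' x) ->
  (forall b w x, F (act b w) x = r b (F w x)) ->
  exists2 h : 'Hom(W, hommod X), h \in homv W (hommod X)
    & forall w x, hval (h w) x = F w x.
Proof.
move=> linF homF linW homW.
have /choice[h hE] w : exists g : hommod X, forall x, hval g x = F w x.
  have [f hf fE] := hom_of (linF w) (homF w).
  by have [g gE] := hvalK hf; exists g => x; rewrite gE fE.
have [||f hf fE] := @hom_of _ _ W (hommod X) h.
- by move=> c w w'; apply: hval_inj => x; rewrite hval_linear !hE linW.
- by move=> b w; apply: hval_inj => x; rewrite hval_act !hE homW.
by exists f => // w x; rewrite fE hE.
Qed.

Lemma hommod_map X Y (h : 'Hom(X, Y)) : h \in homv X Y ->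
  exists2 t : 'Hom(hommod Y, hommod X), t \in homv (hommod Y) (hommod X)
    & forall f x, hval (t f) x = hval f (h x).
Proof.
move=> hh; apply: hom_to_hommod => [f c x y|f a x|c f g x|b f x].
- by rewrite !linearP.
- by rewrite !hom_act // hvalP.
- exact: hval_linear.
- exact: hval_act.
Qed.

Lemma hommod_summand X Y : summand Y X -> summand (hommod Y) (hommod X).
Proof.
move=> [n [i [p [hi hp pi]]]].
have /choice[s sE] j : exists s : 'Hom(hommod X, hommod Y),
    s \in homv (hommod X) (hommod Y) /\ forall f x, hval (s f) x = hval f (p j x).
  by have [s hs sE] := hommod_map (hp j); exists s.
have /choice[t tE] j : exists t : 'Hom(hommod Y, hommod X),
    t \in homv (hommod Y) (hommod X) /\ forall f x, hval (t f) x = hval f (i j x).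
  by have [t ht tE] := hommod_map (hi j); exists t.
exists n, s, t; split=> [j|j|f]; try by case: (sE j); case: (tE j).
apply: hval_inj => x; rewrite -[in RHS](pi x) linear_sum /hval linear_sum sum_lfunE.
apply: eq_bigr => j _; case: (sE j) (tE j) => _ sjE [_ tjE].
by rewrite -/(hval _) tjE sjE.
Qed.

Lemma hommod_left_exact X Y Z (f : 'Hom(X, Y)) (g : 'Hom(Y, Z)) : ses f g ->
  exists (gs : 'Hom(hommod Z, hommod Y)) (fs : 'Hom(hommod Y, hommod X)),
    [/\ gs \in homv (hommod Z) (hommod Y), fs \in homv (hommod Y) (hommod X),
        forall u x, hval (gs u) x = hval u (g x),
        forall u x, hval (fs u) x = hval u (f x)
      & injective gs /\ forall u, fs u = 0 <-> exists v, u = gs v].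
Proof.
move=> sfg; have [gs hgs gsE] := hommod_map (ses_homr sfg).
have [fs hfs fsE] := hommod_map (ses_homl sfg).
have hval0 W x : hval (0 : hommod W) x = 0 by exact: zero_lfunE.
exists gs, fs; split=> //; split=> [|u]; first apply: lfun_inj => u u0.
  apply: hval_inj => z; have [y ->] := ses_surj sfg z.
  by rewrite -gsE u0 !hval0.
split=> [u0|[v ->]]; last first.
  by apply: hval_inj => x; rewrite fsE gsE (ses_comp0 _ sfg) linear0 hval0.
have [y /(ses_exact sfg)[x ->]|v hv vE] :=
    factor_epi (ses_homr sfg) (hvalP u) (ses_surj sfg).
  by rewrite -fsE u0 hval0.
have [w wE] := hvalK hv; exists w; apply: hval_inj => y.
by rewrite gsE wE vE.
Qed.

(** The extension hypothesis supplies the one missing surjectivity; it will come either from the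
    injectivity of [V] or from the vanishing of Ext^1(Z, V). *)
Lemma hommod_ses X Y Z (f : 'Hom(X, Y)) (g : 'Hom(Y, Z)) : ses f g ->
  (forall u, u \in homv X V ->
     exists2 v, v \in homv Y V & forall x, v (f x) = u x) ->
  exists (gs : 'Hom(hommod Z, hommod Y)) (fs : 'Hom(hommod Y, hommod X)),
    ses gs fs /\ forall u x, hval (gs u) x = hval u (g x).
Proof.
move=> sfg ext; have [gs [fs [hgs hfs gsE fsE [gs_inj ex]]]] := hommod_left_exact sfg.
exists gs, fs; split=> //; split=> // u.
have [v hv vE] := ext _ (hvalP u); have [w wE] := hvalK hv.
by exists w; apply: hval_inj => x; rewrite fsE wE vE.
Qed.

End HomModules.

Arguments commuting_action {k A} B V.

(** * Endomorphism algebras of generator-cogenerators *)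

Section Muller.
Local Open Scope ring_scope.
Context {k : fieldType} {A : falgType k}.
Variables (M : fdmod A) (M_neq0 : (0 < \dim {:M})%N).
Local Notation E := (endalg M_neq0).
Implicit Types (X Y K P : fdmod A) (Z Q : fdmod E).

Definition endo (phi : E) : 'Hom(M, M) := vsval (phi : subvs_of (homv M M)).

Lemma endoP phi : endo phi \in homv M M. Proof. exact: subvsP. Qed.

Lemma endo_linear : linear endo. Proof. by move=> c phi psi; rewrite /endo linearP. Qed.

Lemma endo1 : endo 1 = \1%VF. Proof. by []. Qed.

Lemma endoM phi psi : endo (phi * psi) = (endo phi \o endo psi)%VF. Proof. by []. Qed.

Lemma endoK f : f \in homv M M -> exists phi, endo phi = f.
Proof. by move=> hf; exists (Subvs hf). Qed.

Lemma endo_inj phi psi : (forall x, endo phi x = endo psi x) -> phi = psi.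
Proof. by move=> /lfunP; apply: val_inj. Qed.

Fact evmod_linearl x : linear (fun phi : E => endo phi x).
Proof. by move=> c phi psi; rewrite endo_linear add_lfunE scale_lfunE. Qed.

Fact evmod_linearr phi : linear (endo phi).
Proof. by move=> c x y; rewrite linearP. Qed.

Fact evmod_act1 x : endo 1 x = x. Proof. exact: id_lfunE. Qed.

Fact evmod_actM phi psi x : endo (phi * psi) x = endo phi (endo psi x).
Proof. exact: comp_lfunE. Qed.

Definition evmod : fdmod E :=
  FDMod evmod_linearl evmod_linearr evmod_act1 evmod_actM.

Definition end_action : commuting_action E M :=
  CommutingAction endo_linear endoP endo1 endoM.

Definition scal (a : A) : 'Hom(evmod, evmod) := (linfun (act a) : 'Hom(M, M)).

Lemma scalE a (x : M) : scal a x = act a x.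
Proof. exact: (lfunE (act a : {linear M -> M})). Qed.

Fact scal_linear : linear scal.
Proof.
move=> c a b; apply/lfunP=> x; rewrite add_lfunE scale_lfunE !scalE.
exact: (@act_linearl _ _ M).
Qed.

Fact scal_hom (a : A) : scal a \in homv evmod evmod.
Proof. by apply/homvP=> phi x; rewrite !scalE /= hom_act ?endoP. Qed.

Fact scal1 : scal 1 = \1%VF.
Proof. by apply/lfunP=> x; rewrite scalE id_lfunE act1. Qed.

Fact scalM (a b : A) : scal (a * b) = (scal a \o scal b)%VF.
Proof. by apply/lfunP=> x; rewrite comp_lfunE !scalE actM. Qed.

Definition scalar_action : commuting_action A evmod :=
  CommutingAction scal_linear scal_hom scal1 scalM.

Lemma scalar_actionE (a : A) (x : M) : scalar_action a x = act a x.
Proof. exact: scalE. Qed.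

Local Notation F := (hommod end_action).
Local Notation G := (hommod scalar_action).

Lemma scalar_act_hval Z a (f : G Z) z : hval (act a f) z = act a (hval f z : M).
Proof. by rewrite hval_act scalar_actionE. Qed.

Lemma end_act_hval X phi (f : F X) x : hval (act phi f) x = endo phi (hval f x).
Proof. exact: hval_act. Qed.

Lemma endo_evmod Z (f : 'Hom(Z, evmod)) (phi : E) z :
  f \in homv Z evmod -> f (act phi z) = endo phi (f z).
Proof. exact: hom_act. Qed.

Lemma summand_evmod_regmod : summand evmod (F (regmod A)).
Proof.
have [||s hs sE] := @hom_of _ _ (F (regmod A)) evmod (fun f => hval f 1).
- by move=> c f g; rewrite hval_linear.
- by move=> phi f; rewrite end_act_hval.
have [x c a b|x b a|c x y a|phi x a|t ht tE] :=
    @hom_to_hommod _ _ _ _ end_action (regmod A) evmod (fun x a => act a (x : M)).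
- by rewrite act_linearl.
- by rewrite actM.
- by rewrite act_linearr.
- by rewrite /= hom_act ?endoP.
apply: summand1 hs ht _ => f; apply: hval_inj => a.
by rewrite tE sE -hom_act ?hvalP //= mulr1.
Qed.

Lemma summand_dual_regmod : summand (G (regmod E)) M.
Proof.
have [||s hs sE] := @hom_of _ _ (G (regmod E)) M (fun f => hval f 1).
- by move=> c f g; rewrite hval_linear.
- by move=> a f; rewrite scalar_act_hval.
have [x c phi psi|x phi psi|c x y phi|a x phi|t ht tE] :=
    @hom_to_hommod _ _ _ _ scalar_action (regmod E) M (fun x phi => endo phi x : evmod).
- exact: evmod_linearl.
- exact: evmod_actM.
- by rewrite linearP.
- by rewrite scalar_actionE hom_act ?endoP.
by apply: summand1 ht hs _ => x; rewrite sE tE endo1 id_lfunE.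
Qed.

Lemma summand_evmod_projective P : projective_mod P -> summand evmod (F P).
Proof.
move=> /summand_projective/(hommod_summand end_action).
exact: summand_trans summand_evmod_regmod.
Qed.

Hypotheses (genM : in_add M (regmod A)) (cogM : in_add M (dualmod A)).

(** The trace of a generator contains 1: take for [x] the images of 1 under the inclusions of [A].
    These elements and maps serve as a dual basis throughout the section. *)
Lemma generator_basis : exists n (x : 'I_n -> M) (p : 'I_n -> 'Hom(M, regmod A)),
  (forall j, p j \in homv M (regmod A)) /\ \sum_j p j (x j) = 1.
Proof.
have [n [i [p [hi hp pi]]]] := in_add_summand genM.
by exists n, (fun j => i j 1), p.
Qed.

Lemma generator_act n (x : 'I_n -> M) (p : 'I_n -> 'Hom(M, regmod A)) (y : M) :
  \sum_j p j (x j) = 1 -> \sum_j act (p j (x j)) y = y.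
Proof.
by move=> px; rewrite -[RHS]act1 -px -[RHS]/(actr y _) linear_sum.
Qed.

Lemma generator_endo n (p : 'I_n -> 'Hom(M, regmod A)) j (y : M) :
  (forall j, p j \in homv M (regmod A)) ->
  exists phi : E, forall z, endo phi z = act (p j z) y.
Proof.
move=> hp; have [||f hf fE] := @hom_of _ _ M M (fun z => act (p j z) y).
- by move=> c u v; rewrite linearP act_linearl.
- by move=> a u; rewrite hom_act // actM.
by have [phi phiE] := endoK hf; exists phi => z; rewrite phiE.
Qed.

(** The maps sending z to (p_j z) y are endomorphisms of [M], so [f] commutes with them; evaluate at
    [x j] and sum over j. *)
Lemma generator_eval n (x : 'I_n -> M) (p : 'I_n -> 'Hom(M, regmod A))
    (f : 'Hom(evmod, evmod)) (y : M) :
  (forall j, p j \in homv M (regmod A)) -> \sum_j p j (x j) = 1 ->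
  f \in homv evmod evmod -> \sum_j act (p j (f (x j) : M)) y = f y :> M.
Proof.
move=> hp px hf; rewrite -[in RHS](generator_act y px).
rewrite [RHS](linear_sum f); apply: eq_bigr => j _.
have [phi phiE] := generator_endo j y hp.
by rewrite -!phiE -endo_evmod.
Qed.

Lemma double_centralizer (f : 'Hom(evmod, evmod)) : f \in homv evmod evmod ->
  exists a, forall y : M, f y = act a y.
Proof.
move=> hf; have [n [x [p [hp px]]]] := generator_basis.
exists (\sum_j p j (f (x j) : M)) => y.
by rewrite -(generator_eval y hp px hf) -[RHS]/(actr y _) linear_sum.
Qed.

(** This is the double centralizer property as a statement on modules: an endomorphism f corresponds
    to the sum of the p_j (f x_j), and a scalar to its action on [M]. *)
Lemma summand_regmod_dual_evmod : summand (regmod A) (G evmod).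
Proof.
have [n [x [p [hp px]]]] := generator_basis.
have [||s hs sE] := @hom_of _ _ (G evmod) (regmod A)
    (fun f => \sum_j p j (hval f (x j) : M)).
- move=> c f g; rewrite linear_sum -big_split; apply: eq_bigr => j _.
  by rewrite hval_linear linearP.
- move=> a f; rewrite linear_sum; apply: eq_bigr => j _.
  by rewrite scalar_act_hval hom_act.
have [a c u v|a phi u|c a b u|a b u|t ht tE] :=
    @hom_to_hommod _ _ _ _ scalar_action evmod (regmod A) (fun a u => act a (u : M)).
- exact: (@act_linearr _ _ M).
- by rewrite /= hom_act ?endoP.
- exact: (@act_linearl _ _ M).
- by rewrite scalar_actionE -actM.
apply: summand1 hs ht _ => f; apply: hval_inj => y.
by rewrite tE sE -(generator_eval y hp px (hvalP f)) -[LHS]/(actr (y : M) _) linear_sum.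
Qed.

(** The decomposition through copies of E sends y to the endomorphism taking z to (p_j z) y, and
    returns to [M] by evaluation at [x j]. *)
Lemma evmod_projective : projective_mod evmod.
Proof.
apply: projective_summand (@projective_regmod _ E) _.
have [n [x [p [hp px]]]] := generator_basis.
have /choice[i iE] j : exists i : 'Hom(evmod, regmod E),
    i \in homv evmod (regmod E) /\ forall y z, endo (i y) z = act (p j z) (y : M).
  have /choice[c cE] y := generator_endo j y hp.
  have [||i hi iE] := @hom_of _ _ evmod (regmod E) c.
  - move=> a y y'; apply: endo_inj => z.
    by rewrite endo_linear add_lfunE scale_lfunE !cE act_linearr.
  - move=> phi y; apply: endo_inj => z.
    by rewrite endoM comp_lfunE !cE /= hom_act ?endoP.
  by exists i; split=> // y z; rewrite iE cE.
have /choice[q qE] j : exists q : 'Hom(regmod E, evmod),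
    q \in homv (regmod E) evmod /\ forall phi, q phi = endo phi (x j).
  have [||q hq qE] := @hom_of _ _ (regmod E) evmod (fun phi => endo phi (x j)).
  - by move=> c phi psi; rewrite endo_linear add_lfunE scale_lfunE.
  - by move=> phi psi; rewrite endoM comp_lfunE.
  by exists q.
exists n, i, q; split=> [j|j|y]; try by case: (iE j); case: (qE j).
rewrite -[RHS](generator_act (y : M) px); apply: eq_bigr => j _.
by case: (qE j) => _ ->; case: (iE j) => _ ->.
Qed.

(* As D(A) is a summand of a power of M, the right E-module
   Hom_A(M, D(A)) = D(M) is a summand of a power of E; dually M is a summand of
   a power of D(E). The endomorphisms [e j l] below come from the functionals l
   on M through this identification. *)
Lemma evmod_injective : injective_mod evmod.
Proof.
apply: injective_summand (@injective_dualmod _ E) _.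
have [n [i [p [hi hp pi]]]] := in_add_summand cogM.
have /choice[theta thetaE] (l : 'Hom(M, k^o)) : exists t : 'Hom(M, dualmod A),
    t \in homv M (dualmod A) /\ forall x a, (t x : 'Hom(A, k^o)) a = l (act a x).
  by have [t ht tE] := hom_to_dual l; exists t.
have thetaD c l l' x : theta (c *: l + l') x = c *: theta l x + theta l' x.
  apply/lfunP=> a; case: (thetaE (c *: l + l')) (thetaE l) (thetaE l').
  by move=> _ E1 [_ E2] [_ E3]; rewrite !(add_lfunE, scale_lfunE) E1 E2 E3
    add_lfunE scale_lfunE.
have theta_endo l (phi : E) x : theta (l \o endo phi)%VF x = theta l (endo phi x).
  apply/lfunP=> a; case: (thetaE (l \o endo phi)%VF) (thetaE l) => _ E1 [_ E2].
  by rewrite E1 E2 comp_lfunE hom_act ?endoP.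
have /choice[e eE] j : exists e : 'Hom(M, k^o) -> E,
    forall l x, endo (e l) x = i j (theta l x).
  have /choice[e0 e0E] l : exists phi : E, forall x, endo phi x = i j (theta l x).
    case: (thetaE l) => hl _.
    have [phi phiE] := endoK (homv_comp (hi j) hl); exists phi => x.
    by rewrite phiE comp_lfunE.
  by exists e0.
have sep (x y : M) : (forall l : 'Hom(M, k^o), l x = l y) -> x = y.
  move=> xy; apply/eqP; rewrite -subr_eq0; apply/eqP/functionals_separate => l.
  by rewrite linearB /= xy subrr.
pose b := vbasis {:M}.
have /choice[c cE] (t : 'I_(\dim {:M})) : exists c : 'Hom(M, k^o),
    forall x, c x = coord b t x.
  by apply: lfun_of => a x y; rewrite linearP.
have expand (l : 'Hom(M, k^o)) : l = \sum_(t < \dim {:M}) l b`_t *: c t.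
  apply/lfunP=> x; rewrite sum_lfunE {1}(coord_vbasis (memvf x)) linear_sum.
  by apply: eq_bigr => t _; rewrite scale_lfunE cE linearZ; apply: mulrC.
have e_lin j : linear (e j).
  move=> a l l'; apply: endo_inj => x.
  by rewrite endo_linear add_lfunE scale_lfunE !eE thetaD linearP.
pose eL j : {linear 'Hom(M, k^o) -> E} :=
  HB.pack (e j) (GRing.isLinear.Build _ _ _ _ _ (e_lin j)).
(* Under the identification of [M] with its double dual, this is the element representing the
   functional that sends l to psi (e_j l). *)
pose q j (psi : dualmod E) : M :=
  \sum_(t < \dim {:M}) (psi : 'Hom(E, k^o)) (e j (c t)) *: b`_t.
have qE j psi (l : 'Hom(M, k^o)) : l (q j psi) = (psi : 'Hom(E, k^o)) (e j l).
  rewrite /q [in RHS](expand l) linear_sum -[e j]/(eL j : _ -> _) linear_sum linear_sum.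
  by apply: eq_bigr => t _; rewrite !linearZ; apply: mulrC.
have /choice[r rE] j : exists r : 'Hom(dualmod E, evmod),
    r \in homv (dualmod E) evmod /\ forall psi, r psi = q j psi.
  have [||r hr rE] := @hom_of _ _ (dualmod E) evmod (q j).
  - move=> a psi psi'; apply: sep => l.
    by rewrite linearP /= !qE add_lfunE scale_lfunE.
  - move=> phi psi; apply: sep => l.
    rewrite qE dual_actE -[RHS]comp_lfunE qE; congr ((psi : 'Hom(E, k^o)) _).
    by apply: endo_inj => x; rewrite endoM comp_lfunE !eE theta_endo.
  by exists r.
have /choice[s sE] j : exists s : 'Hom(evmod, dualmod E),
    s \in homv evmod (dualmod E) /\
    forall x phi, (s x : 'Hom(E, k^o)) phi = (p j (endo phi x) : 'Hom(A, k^o)) 1.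
  have [l lE] : exists l : 'Hom(evmod, k^o), forall x : M, l x = (p j x : 'Hom(A, k^o)) 1.
    by apply: lfun_of => a x y; rewrite linearP add_lfunE scale_lfunE.
  have [s hs sE] := hom_to_dual l.
  by exists s; split=> // x phi; rewrite sE lE.
exists n, s, r; split=> [j|j|x]; try by case: (sE j); case: (rE j).
apply: sep => l; rewrite linear_sum.
case: (thetaE l) => _ thl.
transitivity ((theta l x : 'Hom(A, k^o)) 1); last by rewrite thl act1.
rewrite -[theta l x]pi sum_lfunE; apply: eq_bigr => j _.
by case: (rE j) => _ ->; case: (sE j) => _ sjE; rewrite /= qE sjE eE.
Qed.

(** By injectivity it is enough that homomorphisms to [M] separate the points of [Q]. They do, since
    the projective [Q] lies in a power of E and E acts faithfully on [M]. *)
Lemma summand_evmod Q : projective_mod Q -> injective_mod Q -> summand evmod Q.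
Proof.
move=> projQ injQ; apply: summand_of_separated => // q q0.
have [n [i [p [hi hp pi]]]] := summand_projective projQ.
rewrite -(pi q) big1 // => j _; suff -> : i j q = 0 by rewrite linear0.
apply: endo_inj => x.
have [||f hf fE] := @hom_of _ _ Q evmod (fun q => endo (i j q) x).
- by move=> c u v; rewrite linearP endo_linear add_lfunE scale_lfunE.
- by move=> phi u; rewrite hom_act //; apply: evmod_actM.
by rewrite -fE q0 //; symmetry; apply: zero_lfunE.
Qed.

Lemma dual_projective Q : summand evmod Q -> projective_mod (G Q).
Proof.
move=> /(hommod_summand scalar_action) GQ.
exact: projective_summand projective_regmod (summand_trans summand_regmod_dual_evmod GQ).
Qed.

(** Half of the reflexivity of [Q] under the two dualities. By the double centralizer property the
    projections of [Q] to [M] generate [G Q] over A, so [Phi] is determined by its values on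
    them. *)
Lemma dual_eval Q (Phi : 'Hom(G Q, M)) : summand evmod Q -> Phi \in homv (G Q) M ->
  exists q, forall f, Phi f = hval f q.
Proof.
move=> [n [i [p [hi hp pi]]]] hPhi.
have /choice[h hE] j : exists h : G Q, hval h = i j by exact: hvalK.
exists (\sum_j p j (Phi (h j) : evmod)) => f.
have /choice[a aE] j : exists a, forall y : M, hval f (p j y) = act a y.
  have [a aE] := double_centralizer (homv_comp (hvalP f) (hp j)).
  by exists a => y; rewrite -aE comp_lfunE.
have fE : f = \sum_j act (a j) (h j).
  apply: hval_inj => q; rewrite -[in LHS](pi q) linear_sum {2}/hval linear_sum sum_lfunE.
  apply: eq_bigr => j _.
  by rewrite -/(hval _) scalar_act_hval hE -aE.
rewrite [in LHS]fE !linear_sum; apply: eq_bigr => j _.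
by rewrite -[LHS]/(Phi (act (a j) (h j))) hom_act // -aE.
Qed.

(** Pulled back to [G Q], the map [Phi] is evaluation at some q. Maps to [M] separate the points of
    [Q1], and those that factor through [h1] vanish on [Z]; hence q is killed by [h1] and comes from
    [Z]. *)
Lemma dual_eval_sub Z Q Q1 (h : 'Hom(Z, Q)) (h1 : 'Hom(Q, Q1)) (Phi : 'Hom(G Z, M)) :
  h \in homv Z Q -> h1 \in homv Q Q1 -> injective h ->
  (forall q, h1 q = 0 <-> exists z, q = h z) ->
  summand evmod Q -> summand evmod Q1 -> Phi \in homv (G Z) M ->
  exists z, forall f, Phi f = hval f z.
Proof.
move=> hh hh1 h_inj ex sQ [n [i [p [hi hp pi]]]] hPhi.
have [t ht tE] := hommod_map scalar_action hh.
have [q qE] := dual_eval sQ (homv_comp hPhi ht).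
have /ex[z qz] : h1 q = 0.
  rewrite -[h1 q]pi big1 // => j _; suff -> : i j (h1 q) = 0 by rewrite linear0.
  have [u uE] := hvalK scalar_action (homv_comp (hi j) hh1).
  rewrite -[LHS]comp_lfunE -uE -qE comp_lfunE; have -> : t u = 0.
    apply: hval_inj => x; rewrite tE uE comp_lfunE (ex (h x)).2; last by exists x.
    by rewrite linear0; symmetry; apply: zero_lfunE.
  exact: linear0.
exists z => f.
have [g hg gE] :=
  (injective_modP _).1 evmod_injective _ _ _ _ hh (hvalP f) h_inj.
have [u uE] := hvalK scalar_action hg.
have -> : f = t u by apply: hval_inj => x; rewrite tE uE gE.
by rewrite -[LHS]comp_lfunE qE qz tE.
Qed.

(** Dualizing the first sequence of the resolution gives a projective presentation of [G Z], so the
    induction passes to the tail. Vanishing of Ext^(n+1) uses the terms of index 0 to n + 2: the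
    last two make the final cosyzygy reflexive. *)
Lemma ext_vanish_dual n Z (I : nat -> fdmod E) (e : 'Hom(Z, I 0%N))
    (d : forall i, 'Hom(I i, I i.+1)) : injective_resolution e d ->
  (forall i, (i < n.+3)%N -> projective_mod (I i)) -> ext_vanish n (G Z) M.
Proof.
elim: n Z I e d => [|n IHn] Z I e d res projI;
  have [Z1 [p [e1 [sep dE tail]]]] := injective_resolution_tail res.
  have ext u (hu : u \in homv Z evmod) :=
    (injective_modP _).1 evmod_injective _ _ _ _ (ses_homl sep) hu (ses_inj sep).
  have [ps [es [ses_dual psE]]] := hommod_ses scalar_action sep ext.
  have sI i : (i < 3)%N -> summand evmod (I i).
    by move=> i3; apply: summand_evmod; [apply: projI | apply: (@ires_inj _ _ _ _ _ _ res)].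
  apply/(ext1_zeroP _ ses_dual (dual_projective (sI 0%N isT))) => Phi hPhi.
  (* A map from the syzygy [G Z1] to [M] is evaluation at some [z1]; evaluation at a preimage of
     [z1] in [I 0] extends it to [G (I 0)]. *)
  have [||z1 z1E] := dual_eval_sub (ires_hom0 tail) (ires_hom tail 0%N) _ _
      (sI 1%N isT) (sI 2%N isT) hPhi.
  - exact/lker0I/(ires_mono tail).
  - by move=> q; rewrite -limgP (ires_exact0 tail) memv_ker; split=> /eqP.
  have [q qz] := ses_surj sep z1.
  have [||Psi hPsi PsiE] := @hom_of _ _ (G (I 0%N)) M (fun f => hval f q).
  - by move=> c f g; rewrite hval_linear.
  - by move=> a f; rewrite scalar_act_hval.
  by exists Psi => // f; rewrite PsiE psE -qz z1E.
have ext u (hu : u \in homv Z evmod) :=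
  (injective_modP _).1 evmod_injective _ _ _ _ (ses_homl sep) hu (ses_inj sep).
have [ps [es [ses_dual _]]] := hommod_ses scalar_action sep ext.
have proj0 : projective_mod (G (I 0%N)).
  apply/dual_projective/summand_evmod; first exact: projI.
  exact: (@ires_inj _ _ _ _ _ _ res).
apply/(ext_vanish_syzygy _ _ ses_dual proj0); apply: IHn tail _ => i ni.
exact: projI.
Qed.

Lemma ext_vanish_of_domdim n (I : nat -> fdmod E) (e : 'Hom(regmod E, I 0%N))
    (d : forall i, 'Hom(I i, I i.+1)) : injective_resolution e d ->
  (forall i, (i < n.+3)%N -> projective_mod (I i)) ->
  ext_vanish n (dualmod A) (regmod A).
Proof.
move=> res projI; have E0 := ext_vanish_dual res projI.
apply: ext_vanish_summandl (in_add_summand cogM).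
apply: ext_vanish_summandr (in_add_summand genM).
exact: ext_vanish_summandl E0 summand_dual_regmod.
Qed.

Lemma hom_projective_injective P : projective_mod P ->
  projective_mod (F P) /\ injective_mod (F P).
Proof.
move=> /summand_evmod_projective FP; split.
  exact: projective_summand evmod_projective FP.
exact: injective_summand evmod_injective FP.
Qed.

(** A projective cover sequence of [X] dualizes to an embedding of [F X] in the projective-injective
    [F P]. If Ext^1(X, M) vanishes, its cokernel is [F K] and the induction continues. Left
    exactness alone always yields two terms, whence the shift by 2. *)
Lemma domdim_ge_hom n X :
  (forall i, (i < n)%N -> ext_vanish i X M) -> domdim_ge n.+2 (F X).
Proof.
elim: n X => [|n IHn] X E0; have [K [P [i [p [sip projP]]]]] := ses_projective X;
  have [projFP injFP] := hom_projective_injective projP.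
  have [ps [us [hps hus _ _ [ps_inj ex]]]] := hommod_left_exact end_action sip.
  have [C [g sg]] := ses_coker hps ps_inj.
  (* The cokernel [C] embeds in [F K], which embeds in [F P'] for a projective [P'] covering [K]. *)
  have [u /(ses_exact sg)/ex//|v hv vE] := factor_epi (ses_homr sg) hus (ses_surj sg).
  have v_inj : injective v.
    apply: lfun_inj => z; have [y ->] := ses_surj sg z.
    by rewrite vE => /ex/(ses_exact sg).
  have [K' [P' [i' [p' [sip' projP']]]]] := ses_projective K.
  have [projFP' injFP'] := hom_projective_injective projP'.
  have [qs [_ [hqs _ _ _ [qs_inj _]]]] := hommod_left_exact end_action sip'.
  have qv_inj : injective (qs \o v)%VF.
    by move=> x y; rewrite !comp_lfunE => /qs_inj/v_inj.
  have [C' [g' sg']] := ses_coker (homv_comp hqs hv) qv_inj.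
  exists (F P), C, ps, g; split=> //.
  by exists (F P'), C', (qs \o v)%VF, g'; split.
have ext := (ext1_zeroP _ sip projP).1 (E0 0%N isT).
have [ps [us [s _]]] := hommod_ses end_action sip ext.
exists (F P), (F K), ps, us; split=> //; apply: IHn => j jn.
exact/(ext_vanish_syzygy _ _ sip projP)/E0.
Qed.

Lemma domdim_of_ext_vanish n : (forall i, (i < n)%N -> ext_vanish i M M) ->
  exists (I : nat -> fdmod E) (e : 'Hom(regmod E, I 0%N))
      (d : forall i, 'Hom(I i, I i.+1)),
    minimal_injective_resolution e d /\ forall i, (i < n.+2)%N -> projective_mod (I i).
Proof.
move=> /domdim_ge_hom dM.
exists (min_inj (regmod E)), (min_in (regmod E) 0), (min_diff (regmod E)).
split=> [|i]; first exact: min_resolution.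
apply: min_projective dM _.
(* The regular module of E is [F M]; a retract of it is all that [min_projective] requires. *)
have [phi c x y|phi a x|c phi psi x|phi psi x|a ha aE] :=
    @hom_to_hommod _ _ _ _ end_action M (regmod E) endo.
- exact: evmod_linearr.
- by rewrite hom_act ?endoP.
- exact: evmod_linearl.
- exact: evmod_actM.
have a_inj : injective a.
  by move=> phi psi aphi; apply: endo_inj => x; rewrite -[LHS]aE -[RHS]aE aphi.
have [f|b hb bE] := factor_mono ha (homv_id _) a_inj.
  have [phi phiE] := endoK (hvalP f); exists phi.
  by rewrite id_lfunE; apply: hval_inj => x; rewrite aE phiE.
exists a, b; split=> [||x]; [exact: ha | exact: hb | apply: a_inj].
by rewrite bE id_lfunE.
Qed.

End Muller.

(** * Rigidity dimension *)

Section ExtendedNaturals.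
Local Open Scope enat_scope.
Implicit Types x y z : enat.

Lemma ele_trans y x z : x <= y -> y <= z -> x <= z.
Proof. by case: x y z => [m|] [n|] [p|] //=; apply: leq_trans. Qed.

Lemma ele_anti x y : x <= y -> y <= x -> x = y.
Proof.
by case: x y => [m|] [n|] //= mn nm; congr Fin; apply/eqP; rewrite eqn_leq mn nm.
Qed.

Lemma einf_Fin (S : set nat) n : einf S = Fin n -> S n.
Proof.
rewrite /einf; case: pselect => // ex [<-].
by case: ex_minnP => m /asboolP.
Qed.

(** A finite supremum of natural numbers is attained. The hypothesis on 0 covers the value [Fin 0],
    which is also the supremum of the empty set. *)
Lemma esup_Fin (S : set nat) n :
  S 0%N -> esup [set Fin m | m in S]%classic = Fin n -> S n.
Proof.
move=> S0; rewrite /esup; case: pselect => // ex [<-].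
case: ex_minnP => -[//|m] /asboolP ub min_m; apply: contrapT => nSm.
suff /min_m : `[< forall x, [set Fin m | m in S]%classic x -> x <= Fin m >].
  by rewrite ltnn.
apply/asboolP => _ [p Sp <-] /=; rewrite -ltnS ltn_neqAle.
have -> : (p <= m.+1)%N by apply: (ub (Fin p)); exists p.
by rewrite andbT; apply/eqP=> pm; apply: nSm; rewrite -pm.
Qed.

End ExtendedNaturals.

Section RigidityDimension.
Context {k : fieldType} {A : falgType k}.

Definition ext_bound : set nat := fun n =>
  forall j, (1 <= j <= n)%N -> ext_zero j (dualmod A) (regmod A).

Local Notation s := (esup [set Fin n | n in ext_bound]%classic).

Lemma ext_bound0 : ext_bound 0. Proof. by case. Qed.

Lemma ext_boundP n :
  ext_bound n <-> forall j, (j < n)%N -> ext_vanish j (dualmod A) (regmod A).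
Proof.
split=> [E j jn|E [|j] //= jn]; first exact/ext_zeroP/E.
exact/ext_zeroP/E.
Qed.

Lemma rigdim_le_ext_bound : (rigdim A <= s + Fin 2)%enat.
Proof.
apply: esup_le => _ [M [M_neq0 [[genM cogM] _ ->]]].
apply: esup_le => _ [t [I [e [d [[res _ _] projI]]]] <-].
(* Dominant dimensions below 2 satisfy the bound trivially; n + 2 projective terms give vanishing in
   degrees 1 to n. *)
case: t projI => [|[|n]] projI; try by case: (s) => //= m; rewrite addn2.
have : (Fin n <= s)%enat.
  apply: esup_ub; exists n => //; apply/ext_boundP => j jn.
  apply: ext_vanish_of_domdim genM cogM _ _ _ _ res _ => i ij.
  by apply: projI; apply: leq_trans ij _.
by case: (s) => //= m nm; rewrite addn2.
Qed.

Local Notation N := (dsum (regmod A) (dualmod A)).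

Lemma generator_cogenerator_reg_dual : generator_cogenerator N.
Proof.
split.
  exists 1%N, (dualmod A).
  have [x|f hf fE] := @pow_map _ _ N N 1 (fun=> \1%VF); first exact: homv_id.
  exists f; split=> //; exists (fun y : powmod N 1 => (y : {ffun 'I_1 -> N}) ord0) => [x|y].
    by rewrite fE id_lfunE.
  by apply/ffunP=> j; rewrite fE id_lfunE [j]ord1.
exists 1%N, (regmod A).
have [||w hw wE] := @hom_of _ _ (dsum (dualmod A) (regmod A)) N (fun x => (x.2, x.1)).
- by move=> c x y.
- by move=> a x.
have [x|f hf fE] := @pow_map _ _ (dsum (dualmod A) (regmod A)) N 1 (fun=> w) => //.
exists f; split=> //; exists (fun y : powmod N 1 =>
  let z := (y : {ffun 'I_1 -> N}) ord0 in (z.2, z.1)) => [x|y].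
  by rewrite fE wE; case: x.
by apply/ffunP=> j; rewrite fE wE [j]ord1; case: (y ord0).
Qed.

(** Of the four components of Ext(N, N), those with first argument [A] or second argument D(A)
    vanish by projectivity or injectivity. *)
Lemma ext_vanish_reg_dual n :
  ext_vanish n (dualmod A) (regmod A) -> ext_vanish n N N.
Proof.
move=> E; apply: ext_vanish_dsumr; apply: ext_vanish_dsuml => //.
- exact/ext_vanish_projective/projective_regmod.
- exact/ext_vanish_injective/injective_dualmod.
- exact/ext_vanish_injective/injective_dualmod.
Qed.

Lemma ext_bound_le_rigdim :
  gldim (endalg (dsum_reg_dual_neq0 A)) <> Inf -> (s + Fin 2 <= rigdim A)%enat.
Proof.
move=> gldN; have genN := generator_cogenerator_reg_dual.
apply: (@ele_trans (domdim (endalg (dsum_reg_dual_neq0 A)))); last first.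
  by apply: esup_ub; exists N, (dsum_reg_dual_neq0 A).
have domN n : ext_bound n -> (Fin n.+2 <= domdim (endalg (dsum_reg_dual_neq0 A)))%enat.
  move=> /ext_boundP E; apply: esup_ub; exists n.+2 => //.
  case: genN => genN cogN.
  apply: (domdim_of_ext_vanish _ genN cogN) => i ni.
  exact/ext_vanish_reg_dual/E.
(* A finite supremum is attained, so [domN] applies to it; if it is infinite, a finite dominant
   dimension would bound it. *)
case es: (s) => [m|]; first by rewrite /= addn2; apply/domN/(esup_Fin ext_bound0).
case ed: (domdim _) => [d|] //; suff : (s <= Fin d)%enat by rewrite es.
apply: esup_le => _ [n /domN + <-]; rewrite ed /= => nd.
by apply: leq_trans nd; rewrite -addn2 leq_addr.
Qed.

(** Every injective module is in add(D(A)), so vanishing up to the injective dimension n would make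
    [A] self-injective. Hence the supremum is at most n - 1, and n is positive because 0 always
    belongs to [ext_bound]. *)
Lemma ext_bound_le_injdim :
  ~ self_injective A -> (s + Fin 2 <= injdim (regmod A) + Fin 1)%enat.
Proof.
move=> nself; case ei: (injdim _) => [n|]; last by case: (s).
have [I [e [d [res I0]]]] := einf_Fin ei.
have lt_n m : ext_bound m -> (m < n)%N.
  move=> /ext_boundP E; rewrite ltnNge; apply/negP=> nm; apply: nself.
  apply: (injective_of_injdim res I0) => j J jn /summand_injective DJ.
  by apply: ext_vanish_summandl DJ; apply: E; apply: leq_trans jn nm.
have n_gt0 := lt_n _ ext_bound0.
have : (s <= Fin n.-1)%enat.
  by apply: esup_le => _ [m /lt_n mn <-]; rewrite /= -ltnS prednK.
by case: (s) => //= m mn; rewrite addn2 addn1 ltnS -(prednK n_gt0) ltnS.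
Qed.

(** If the global dimension is n, then Ext^(n+1)(X, A) vanishes for all X. By dimension shifting
    this is Ext^1 of X with the n-th cosyzygy of [A], which is therefore injective and ends the
    minimal resolution. *)
Lemma injdim_le_gldim : (injdim (regmod A) <= gldim A)%enat.
Proof.
case eg: (gldim A) => [n|]; last by case: (injdim _).
apply/injdim_le/injective_of_ext1_zero => X.
apply/(ext_vanish_min n 0 X (regmod A)); rewrite addn0.
have : (projdim X <= Fin n)%enat by rewrite -eg; apply: esup_ub; exists X.
case ep: (projdim X) => [m|] //= mn.
have [P [e [d [res P0]]]] := einf_Fin ep.
by apply: ext_vanish_projdim res _ => i ni; apply/P0/leq_ltn_trans/ni.
Qed.

End RigidityDimension.

Local Open Scope classical_set_scope.

Theorem theorem3p1 (k : fieldType) (A : falgType k) :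
  ~ self_injective A ->
  let s := esup [set Fin n | n in [set n : nat |
             forall j : nat, (1 <= j <= n)%N ->
               ext_zero j (dualmod A) (regmod A)]] in
  [/\ (rigdim A <= s + Fin 2)%enat,
      gldim (endalg (dsum_reg_dual_neq0 A)) <> Inf -> rigdim A = (s + Fin 2)%enat,
      (rigdim A <= injdim (regmod A) + Fin 1)%enat
    & (injdim (regmod A) + Fin 1 <= gldim A + Fin 1)%enat].
Proof.
move=> nself s; split.
- exact: rigdim_le_ext_bound.
- move=> gld; apply: ele_anti; first exact: rigdim_le_ext_bound.
  exact: ext_bound_le_rigdim.
- apply: ele_trans (rigdim_le_ext_bound) _; exact: ext_bound_le_injdim.
- have := @injdim_le_gldim k A.
  by case: (injdim _) (gldim A) => [m|] [n|] //=; rewrite leq_add2r.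
Qed.
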